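(* Let $H$ be a coquasitriangular Hopf algebra with coquasitriangular structure $\mathcal R:H\otimes H\to k$. Let $\underline H$ be the vector space $H$ with product $$h\bullet g=h_{(2)}g_{(3)}\,\mathcal R(h_{(3)}\otimes Sg_{(1)})\,\mathcal R(h_{(1)}\otimes g_{(2)}),$$ right coaction $\mathrm{Ad}_R(h)=h_{(2)}\otimes(Sh_{(1)})h_{(3)}$ and right action $$h\triangleleft g=h_{(2)}\,\mathcal R(g_{(1)}\otimes h_{(1)})\,\mathcal R(h_{(3)}\otimes g_{(2)}).$$ Then $\underline H$ is a braided-commutative algebra in the category of right Drinfeld–Yetter modules over $H$. Hence there is an action Hopf algebroid $\underline H\#H^{op}$.
   Context: Everything is over a field $k$. A coquasitriangular Hopf algebra is a Hopf algebra $H$ with a convolution-invertible linear map $\mathcal R:H\otimes H\to k$ such that $\mathcal R(h\otimes gf)=\mathcal R(h_{(1)}\otimes f)\mathcal R(h_{(2)}\otimes g)$, $\mathcal R(hg\otimes f)=\mathcal R(h\otimes f_{(1)})\mathcal R(g\otimes f_{(2)})$ and $g_{(1)}h_{(1)}\mathcal R(h_{(2)}\otimes g_{(2)})=\mathcal R(h_{(1)}\otimes g_{(1)})h_{(2)}g_{(2)}$ for all $f,g,h\in H$. A right Drinfeld–Yetter module over $H$ is a vector space $B$ with a right $H$-action $\triangleleft$ and a right $H$-coaction $b\mapsto b_{(0)}\otimes b_{(1)}$ such that $(b\triangleleft h_{(2)})_{(0)}\otimes h_{(1)}(b\triangleleft h_{(2)})_{(1)}=b_{(0)}\triangleleft h_{(1)}\otimes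 b_{(1)}h_{(2)}$. A braided-commutative algebra in this category is such a $B$ that is a unital algebra which is a right $H$-module algebra and a right $H$-comodule algebra (with $(ab)_{(0)}\otimes(ab)_{(1)}=a_{(0)}b_{(0)}\otimes a_{(1)}b_{(1)}$), and such that $ab=b_{(0)}(a\triangleleft b_{(1)})$ for all $a,b\in B$. For such $B$, the action Hopf algebroid $B\#H^{op}$ is the left bialgebroid over $B$ (which is a left and anti-left Hopf algebroid) on the vector space $B\otimes H$ with product $(a\#h)(b\#g)=a(b\triangleleft h_{(1)})\#gh_{(2)}$, source $s(a)=a\#1$, target $t(a)=a_{(0)}\#a_{(1)}$, coproduct $\Delta(a\#h)=(a\#h_{(1)})\otimes_B(1\#h_{(2)})$ and counit $\varepsilon(a\#h)=a\varepsilon(h)$. *)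

(* Defs.v *)
From HB Require Import structures.
From mathcomp Require Import all_boot all_order all_algebra finmap generic_quotient.
From mathcomp Require Import boolp monalg.

Set Implicit Arguments.
Unset Strict Implicit.
Unset Printing Implicit Defensive.

Import GRing.Theory.
Local Open Scope ring_scope.
Local Open Scope quotient_scope.

Reserved Notation "x ⊗ y" (at level 40, left associativity).
Reserved Notation "'\sw_' ( x ⊗ y <- t ) E"
  (at level 41, x name, y name, t at level 99, E at level 41, right associativity,
   format "'[' '\sw_' ( x  ⊗  y  <-  t ) '/  '  E ']'").
Reserved Notation "'\sw3_' ( x ⊗ y ⊗ z <- t ) E"
  (at level 41, x name, y name, z name, t at level 99, E at level 41,
   right associativity,
   format "'[' '\sw3_' ( x  ⊗  y  ⊗  z  <-  t ) '/  '  E ']'").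
Reserved Notation "'\swb_' ( x ⊗ y <- t ) E"
  (at level 41, x name, y name, t at level 99, E at level 41, right associativity,
   format "'[' '\swb_' ( x  ⊗  y  <-  t ) '/  '  E ']'").

Section Quotient.
Variables (k : fieldType) (V : lmodType k) (P : V -> Prop).

Definition lspan_prop (v : V) : Prop :=
  exists2 s : seq (k * V), {in s, forall p, P p.2} & v = \sum_(p <- s) p.1 *: p.2.

Definition lspan : {pred V} := fun v => `[< lspan_prop v >].

Lemma lspanP v : reflect (lspan_prop v) (v \in lspan).
Proof. exact: asboolP. Qed.

Lemma lspan_submod_closed : submod_closed lspan.
Proof.
split=> [|a u v]; first by apply/lspanP; exists [::]; rewrite ?big_nil.
move=> /lspanP[s Ps ->] /lspanP[r Pr ->]; apply/lspanP.
exists ([seq (a * p.1, p.2) | p <- s] ++ r).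
  move=> p; rewrite mem_cat => /orP[/mapP[q qs ->]|/Pr//] /=.
  exact: Ps.
rewrite big_cat big_map /= scaler_sumr; congr (_ + _).
by apply: eq_bigr => p _; rewrite scalerA.
Qed.

HB.instance Definition _ := GRing.isSubmodClosed.Build k V lspan lspan_submod_closed.

Lemma lspan_gen v : P v -> v \in lspan.
Proof.
move=> Pv; apply/lspanP; exists [:: (1, v)].
  by move=> p; rewrite inE => /eqP ->.
by rewrite big_seq1 scale1r.
Qed.

Definition lquot := Quotient.quot lspan.
HB.instance Definition _ := GRing.Zmodule.on lquot.
HB.instance Definition _ := EqQuotient.on lquot.

Definition lclass (u : V) : lquot := \pi_lquot u.

Lemma lclass_repr (x : lquot) : lclass (repr x) = x.
Proof. exact: reprK. Qed.

Lemma lclass_eqP (u v : V) : lclass u = lclass v <-> u - v \in lspan.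
Proof. by rewrite Quotient.idealrBE; split=> /eqP. Qed.

Lemma lclass_ind (Q : lquot -> Prop) : (forall u, Q (lclass u)) -> forall x, Q x.
Proof. by move=> Qu x; rewrite -[x]lclass_repr. Qed.

Definition lquot_scale (a : k) (x : lquot) : lquot := lclass (a *: repr x).

Fact lclassZ a (u : V) : lquot_scale a (lclass u) = lclass (a *: u).
Proof.
by apply/lclass_eqP; rewrite -scalerBr rpredZ //; apply/lclass_eqP/lclass_repr.
Qed.

Fact lclassD (u v : V) : lclass u + lclass v = lclass (u + v).
Proof. by rewrite /lclass raddfD. Qed.

Fact lquot_scaleA a b x :
  lquot_scale a (lquot_scale b x) = lquot_scale (a * b) x.
Proof. by elim/lclass_ind: x => x; rewrite !lclassZ scalerA. Qed.
Fact lquot_scale1 : left_id 1 lquot_scale.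
Proof. by elim/lclass_ind=> x; rewrite lclassZ scale1r. Qed.
Fact lquot_scaleDr : right_distributive lquot_scale +%R.
Proof.
move=> a; elim/lclass_ind=> x; elim/lclass_ind=> y.
by rewrite lclassD !lclassZ lclassD scalerDr.
Qed.
Fact lquot_scaleDl x : {morph lquot_scale^~ x : a b / a + b}.
Proof.
by move=> a b; elim/lclass_ind: x => x; rewrite !lclassZ lclassD scalerDl.
Qed.

HB.instance Definition _ := GRing.Zmodule_isLmodule.Build k lquot
  lquot_scaleA lquot_scale1 lquot_scaleDr lquot_scaleDl.

Fact lclass_linear : linear lclass.
Proof. by move=> a u v; rewrite -lclassD -lclassZ. Qed.
HB.instance Definition _ := GRing.isLinear.Build k V lquot _ lclass lclass_linear.

Lemma linear_lspan (U : lmodType k) (f : {linear V -> U}) :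
  (forall v, P v -> f v = 0) -> {in lspan, forall v, f v = 0}.
Proof.
move=> fP v /lspanP[s Ps ->]; rewrite linear_sum big1_seq // => p /andP[_ ps].
by rewrite linearZ /= fP ?scaler0 //; exact: Ps.
Qed.

Lemma lquot_lift (U : lmodType k) (f : {linear V -> U}) :
  (forall v, P v -> f v = 0) -> forall u, f (repr (lclass u)) = f u.
Proof.
move=> fP u; apply/eqP; rewrite -subr_eq0 -linearB; apply/eqP.
by apply: (linear_lspan fP); apply/lclass_eqP; rewrite lclass_repr.
Qed.

End Quotient.

Definition bilinear_map (k : fieldType) (V W U : lmodType k) (f : V -> W -> U) : Prop :=
  (forall y, linear (f^~ y)) /\ (forall x, linear (f x)).

Section Tensor.
Variables (k : fieldType) (V W : lmodType k).

Definition bilinear_rel (u : {malg k[(V * W)%type]}) : Prop :=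
  (exists a x x' y, u = << (a *: x + x', y) >> - a *: << (x, y) >> - << (x', y) >>) \/
  (exists a x y y', u = << (x, a *: y + y') >> - a *: << (x, y) >> - << (x, y') >>).

Definition tensor := lquot bilinear_rel.
HB.instance Definition _ := GRing.Lmodule.on tensor.

Definition tens (x : V) (y : W) : tensor := lclass bilinear_rel << (x, y) >>.

(* [tlift f t] evaluates f on one expression of t as a linear combination of
   pure tensors.  For a bilinear f this is the linear map induced by f, see
   [tlift_tens] and [tlift_linear]; it is meant for bilinear f only. *)
Definition tlift (U : lmodType k) (f : V -> W -> U) (t : tensor) : U :=
  \sum_(p <- msupp (repr t)) (repr t)@_p *: f p.1 p.2.

Definition flift (U : lmodType k) (f : V -> W -> U) (u : {malg k[(V * W)%type]}) : U :=
  \sum_(p <- msupp u) u@_p *: f p.1 p.2.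

Lemma flift_w (U : lmodType k) (f : V -> W -> U) (u : {malg k[(V * W)%type]}) (d : {fset (V * W)%type}) :
  (msupp u `<=` d)%fset -> flift f u = \sum_(p <- d) u@_p *: f p.1 p.2.
Proof.
move=> le_ud; apply: (big_fset_incl _ le_ud) => p _ pu.
by rewrite mcoeff_outdom // scale0r.
Qed.

Fact flift_linear (U : lmodType k) (f : V -> W -> U) : linear (flift f).
Proof.
move=> a u v; pose d := (msupp u `|` msupp v `|` msupp (a *: u + v))%fset.
have le1 : (msupp u `<=` d)%fset by rewrite /d -fsetUA fsubsetUl.
have le2 : (msupp v `<=` d)%fset by rewrite /d -fsetUA fsetUCA fsubsetUl.
have le3 : (msupp (a *: u + v) `<=` d)%fset by rewrite fsubsetUr.
rewrite (flift_w f le1) (flift_w f le2) (flift_w f le3) scaler_sumr -big_split.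
by apply: eq_bigr => p _ /=; rewrite mcoeffD mcoeffZ scalerDl scalerA.
Qed.
HB.instance Definition _ (U : lmodType k) (f : V -> W -> U) :=
  GRing.isLinear.Build k {malg k[(V * W)%type]} U _ (@flift U f) (flift_linear f).

Lemma fliftU (U : lmodType k) (f : V -> W -> U) x y : flift f << (x, y) >> = f x y.
Proof.
by rewrite (flift_w f (msuppU_le)) big_seq_fset1 mcoeffUU scale1r.
Qed.

Lemma flift_rel (U : lmodType k) (f : V -> W -> U) : bilinear_map f ->
  forall u, bilinear_rel u -> flift f u = 0.
Proof.
move=> [fl fr] u [] [a [x [x' [y ->]]]]; rewrite !linearB linearZ /= !fliftU.
  by rewrite fl /= addrAC addrK subrr.
by rewrite fr /= addrAC addrK subrr.
Qed.

Lemma tlift_class (U : lmodType k) (f : V -> W -> U) u : bilinear_map f ->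
  tlift f (lclass bilinear_rel u) = flift f u.
Proof. by move=> bf; exact: (lquot_lift (flift_rel bf)). Qed.

Lemma tlift_tens (U : lmodType k) (f : V -> W -> U) x y : bilinear_map f ->
  tlift f (tens x y) = f x y.
Proof. by move=> bf; rewrite tlift_class // fliftU. Qed.

Lemma tlift_linear (U : lmodType k) (f : V -> W -> U) : bilinear_map f -> linear (tlift f).
Proof.
move=> bf a t u; rewrite -[t]lclass_repr -[u]lclass_repr -linearP !tlift_class //.
by rewrite linearP.
Qed.

Lemma tens_bilinear : bilinear_map tens.
Proof.
split=> [y a x x'|x a y y']; rewrite /tens -linearP; apply/lclass_eqP;
  rewrite opprD addrA; apply: lspan_gen; [left|right].
- by exists a, x, x', y.
- by exists a, x, y, y'.
Qed.

Lemma tens_span (t : tensor) :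
  exists s : seq (k * (V * W)), t = \sum_(p <- s) p.1 *: tens p.2.1 p.2.2.
Proof.
exists [seq ((repr t)@_p, p) | p <- msupp (repr t)].
rewrite big_map -[LHS]lclass_repr {1}[repr t]monalgE linear_sum /=.
apply: eq_bigr => -[x y] _; rewrite /tens -linearZ; congr lclass.
by apply/malgP => q; rewrite mcoeffZ !mcoeffU mulrnAr mulr1.
Qed.

End Tensor.

Notation "V ⊗ W" := (tensor V%type W%type) : type_scope.
Notation "x ⊗ y" := (tens x y) : ring_scope.
Notation "'\sw_' ( x ⊗ y <- t ) E" := (tlift (fun x y => E) t) : ring_scope.
Notation "'\sw3_' ( x ⊗ y ⊗ z <- t ) E" :=
  (tlift (fun xy z => tlift (fun x y => E) xy) t) : ring_scope.

(* V ⊗_B W as a quotient of V ⊗ W, where r gives the right action of B on V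
   and l the left action of B on W. *)
Section BalancedTensor.
Variables (k : fieldType) (B V W : lmodType k) (r : B -> V -> V) (l : B -> W -> W).

Definition bal_rel (u : V ⊗ W) : Prop :=
  exists b x y, u = r b x ⊗ y - x ⊗ l b y.

Definition btensor := lquot bal_rel.
HB.instance Definition _ := GRing.Lmodule.on btensor.

Definition bclass (u : V ⊗ W) : btensor := lclass bal_rel u.
HB.instance Definition _ := GRing.Linear.copy bclass (lclass bal_rel).

Definition btens (x : V) (y : W) : btensor := bclass (x ⊗ y).

(* As for [tlift]: the map induced by f when f is bilinear and balanced. *)
Definition blift (U : lmodType k) (f : V -> W -> U) (t : btensor) : U :=
  tlift f (repr t).

Lemma blift_class (U : lmodType k) (f : V -> W -> U) (u : V ⊗ W) :
  bilinear_map f -> (forall b x y, f (r b x) y = f x (l b y)) ->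
  blift f (bclass u) = tlift f u.
Proof.
move=> bf balf.
pose g := GRing.isLinear.Build k (tensor V W) U _ (tlift f) (tlift_linear bf).
pose F : {linear (V ⊗ W)%type -> U} := HB.pack (tlift f) g.
apply: (@lquot_lift k (tensor V W) bal_rel U F) => _ [b [x [y ->]]].
by rewrite linearB /= !tlift_tens // balf subrr.
Qed.

End BalancedTensor.

Notation "'\swb_' ( x ⊗ y <- t ) E" := (blift (fun x y => E) t) : ring_scope.

HB.mixin Record Lmodule_isCoalgebra (k : fieldType) C of GRing.Lmodule k C := {
  comul : {linear C -> (C ⊗ C)%type};
  counit : {linear C -> k^o};
  comulA : forall c : C,
    \sw_(c1 ⊗ c2 <- comul c) comul c1 ⊗ c2 =
    \sw_(c1 ⊗ c2 <- comul c) \sw_(d1 ⊗ d2 <- comul c2) (c1 ⊗ d1) ⊗ d2;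
  counitl : forall c : C, \sw_(c1 ⊗ c2 <- comul c) (counit c1 : k) *: c2 = c;
  counitr : forall c : C, \sw_(c1 ⊗ c2 <- comul c) (counit c2 : k) *: c1 = c
}.

#[short(type="coalgType")]
HB.structure Definition Coalgebra (k : fieldType) :=
  { C of GRing.Lmodule k C & Lmodule_isCoalgebra k C }.

(* The condition 1 != 0 built into algebras is no restriction here: it follows
   from counit 1 = 1. *)
HB.mixin Record Coalgebra_isHopf (k : fieldType) H
    of Coalgebra k H & GRing.Algebra k H := {
  comul1 : comul (1 : H) = 1 ⊗ 1;
  comulM : forall h g : H, comul (h * g) =
    \sw_(h1 ⊗ h2 <- comul h) \sw_(g1 ⊗ g2 <- comul g) (h1 * g1) ⊗ (h2 * g2);
  counit1 : counit (1 : H) = 1;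
  counitM : forall h g : H, counit (h * g) = counit h * counit g;
  antipode : {linear H -> H};
  antipodel : forall h : H,
    \sw_(h1 ⊗ h2 <- comul h) antipode h1 * h2 = (counit h : k) *: 1;
  antipoder : forall h : H,
    \sw_(h1 ⊗ h2 <- comul h) h1 * antipode h2 = (counit h : k) *: 1
}.

#[short(type="hopfAlgType")]
HB.structure Definition Hopf (k : fieldType) :=
  { H of Coalgebra k H & GRing.Algebra k H & Coalgebra_isHopf k H }.

Definition comul2 (k : fieldType) (C : coalgType k) (c : C) : (C ⊗ C) ⊗ C :=
  \sw_(c1 ⊗ c2 <- comul c) comul c1 ⊗ c2.

Record coquasitriangular (k : fieldType) (H : hopfAlgType k)
    (R : {linear (H ⊗ H)%type -> k^o}) : Prop := Coquasitriangular {
  cqt_invertible : exists Rinv : {linear (H ⊗ H)%type -> k^o},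
    (forall h g : H,
      \sw_(h1 ⊗ h2 <- comul h) \sw_(g1 ⊗ g2 <- comul g)
        R (h1 ⊗ g1) * Rinv (h2 ⊗ g2) = counit h * counit g) /\
    (forall h g : H,
      \sw_(h1 ⊗ h2 <- comul h) \sw_(g1 ⊗ g2 <- comul g)
        Rinv (h1 ⊗ g1) * R (h2 ⊗ g2) = counit h * counit g);
  cqt_mulr : forall h g f : H,
    R (h ⊗ (g * f)) = \sw_(h1 ⊗ h2 <- comul h) R (h1 ⊗ f) * R (h2 ⊗ g);
  cqt_mull : forall h g f : H,
    R ((h * g) ⊗ f) = \sw_(f1 ⊗ f2 <- comul f) R (h ⊗ f1) * R (g ⊗ f2);
  cqt_comm : forall h g : H,
    \sw_(h1 ⊗ h2 <- comul h) \sw_(g1 ⊗ g2 <- comul g)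
      (R (h2 ⊗ g2) : k) *: (g1 * h1) =
    \sw_(h1 ⊗ h2 <- comul h) \sw_(g1 ⊗ g2 <- comul g)
      (R (h1 ⊗ g1) : k) *: (h2 * g2)
}.

(* Algebra structures on a vector space are unbundled below, because the
   transmuted product lives on the carrier of H, next to the product of H. *)
Record is_algebra (k : fieldType) (A : lmodType k) (mul : A -> A -> A) (one : A)
    : Prop := IsAlgebra {
  alg_bilinear : bilinear_map mul;
  alg_mulA : associative mul;
  alg_mul1l : left_id one mul;
  alg_mul1r : right_id one mul
}.

Record is_dy_module (k : fieldType) (H : hopfAlgType k) (B : lmodType k)
    (act : B -> H -> B) (coact : B -> B ⊗ H) : Prop := IsDYModule {
  dy_act_bilinear : bilinear_map act;
  dy_act1 : forall b, act b 1 = b;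
  dy_actM : forall b h g, act b (h * g) = act (act b h) g;
  dy_coact_linear : linear coact;
  dy_coact_counit : forall b,
    \sw_(b0 ⊗ b1 <- coact b) (counit b1 : k) *: b0 = b;
  dy_coactA : forall b,
    \sw_(b0 ⊗ b1 <- coact b) coact b0 ⊗ b1 =
    \sw_(b0 ⊗ b1 <- coact b) \sw_(h1 ⊗ h2 <- comul b1) (b0 ⊗ h1) ⊗ h2;
  dy_compat : forall b h,
    \sw_(h1 ⊗ h2 <- comul h) \sw_(c0 ⊗ c1 <- coact (act b h2)) c0 ⊗ (h1 * c1) =
    \sw_(b0 ⊗ b1 <- coact b) \sw_(h1 ⊗ h2 <- comul h) act b0 h1 ⊗ (b1 * h2)
}.

Record dy_algebra_data (k : fieldType) (H : hopfAlgType k) (B : lmodType k) :=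
  DYAlgebraData {
  dy_mul : B -> B -> B;
  dy_one : B;
  dy_act : B -> H -> B;
  dy_coact : B -> B ⊗ H
}.

Record is_braided_commutative_algebra (k : fieldType) (H : hopfAlgType k)
    (B : lmodType k) (D : dy_algebra_data H B) : Prop :=
    IsBraidedCommutativeAlgebra {
  bca_module : is_dy_module (dy_act D) (dy_coact D);
  bca_algebra : is_algebra (dy_mul D) (dy_one D);
  bca_act1 : forall h, dy_act D (dy_one D) h = (counit h : k) *: dy_one D;
  bca_actM : forall a b h, dy_act D (dy_mul D a b) h =
    \sw_(h1 ⊗ h2 <- comul h) dy_mul D (dy_act D a h1) (dy_act D b h2);
  bca_coact1 : dy_coact D (dy_one D) = dy_one D ⊗ 1;
  bca_coactM : forall a b, dy_coact D (dy_mul D a b) =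
    \sw_(a0 ⊗ a1 <- dy_coact D a) \sw_(b0 ⊗ b1 <- dy_coact D b)
      dy_mul D a0 b0 ⊗ (a1 * b1);
  bca_comm : forall a b, dy_mul D a b =
    \sw_(b0 ⊗ b1 <- dy_coact D b) dy_mul D b0 (dy_act D a b1)
}.

(* L ⊗_B L, for the B-bimodule structure b.x.b' = s(b)t(b')x on L. *)
Definition bimod_tensor (k : fieldType) (B L : lmodType k) (mul : L -> L -> L)
    (s t : B -> L) :=
  btensor (fun b x => mul (t b) x) (fun b y => mul (s b) y).

Record bialgebroid_data (k : fieldType) (B L : lmodType k) := BialgebroidData {
  base_mul : B -> B -> B;
  base_one : B;
  tot_mul : L -> L -> L;
  tot_one : L;
  src : B -> L;
  tgt : B -> L;
  tot_comul : L -> bimod_tensor tot_mul src tgt;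
  tot_counit : L -> B
}.

Section LeftBialgebroid.
Variables (k : fieldType) (B L : lmodType k) (D : bialgebroid_data B L).

Local Notation s := (src D).
Local Notation t := (tgt D).
Local Notation Δ := (tot_comul D).
Local Notation ε := (tot_counit D).
Local Notation "x ∙ y" := (tot_mul D x y) (at level 40, left associativity).

Definition bimod_tens : L -> L -> bimod_tensor (tot_mul D) s t :=
  btens (fun b x => t b ∙ x) (fun b y => s b ∙ y).
Definition bimod_class : (L ⊗ L)%type -> bimod_tensor (tot_mul D) s t :=
  bclass (fun b x => t b ∙ x) (fun b y => s b ∙ y).
Local Notation "x ⊙ y" := (bimod_tens x y) (at level 40, left associativity).

(* L ⊗_B L ⊗_B L as a quotient of L ⊗ L ⊗ L. *)
Definition bimod_tensor3_rel (u : (L ⊗ L) ⊗ L) : Prop :=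
  (exists b x y z, u = ((t b ∙ x) ⊗ y) ⊗ z - (x ⊗ (s b ∙ y)) ⊗ z) \/
  (exists b x y z, u = (x ⊗ (t b ∙ y)) ⊗ z - (x ⊗ y) ⊗ (s b ∙ z)).
Definition bimod_tens3 (x y z : L) : lquot bimod_tensor3_rel :=
  lclass bimod_tensor3_rel ((x ⊗ y) ⊗ z).

Record is_left_bialgebroid : Prop := IsLeftBialgebroid {
  lb_base_algebra : is_algebra (base_mul D) (base_one D);
  lb_tot_algebra : is_algebra (tot_mul D) (tot_one D);
  lb_src_linear : linear s;
  lb_src1 : s (base_one D) = tot_one D;
  lb_srcM : forall a b, s (base_mul D a b) = s a ∙ s b;
  lb_tgt_linear : linear t;
  lb_tgt1 : t (base_one D) = tot_one D;
  lb_tgtM : forall a b, t (base_mul D a b) = t b ∙ t a;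
  lb_src_tgt : forall a b, s a ∙ t b = t b ∙ s a;
  lb_comul_linear : linear Δ;
  lb_comul_src : forall b x, Δ (s b ∙ x) = \swb_(x1 ⊗ x2 <- Δ x) (s b ∙ x1) ⊙ x2;
  lb_comul_tgt : forall b x, Δ (t b ∙ x) = \swb_(x1 ⊗ x2 <- Δ x) x1 ⊙ (t b ∙ x2);
  lb_counit_linear : linear ε;
  lb_counit_src : forall b x, ε (s b ∙ x) = base_mul D b (ε x);
  lb_counit_tgt : forall b x, ε (t b ∙ x) = base_mul D (ε x) b;
  lb_comulA : forall x,
    \swb_(x1 ⊗ x2 <- Δ x) \swb_(y1 ⊗ y2 <- Δ x1) bimod_tens3 y1 y2 x2 =
    \swb_(x1 ⊗ x2 <- Δ x) \swb_(y1 ⊗ y2 <- Δ x2) bimod_tens3 x1 y1 y2;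
  lb_counitl : forall x, \swb_(x1 ⊗ x2 <- Δ x) s (ε x1) ∙ x2 = x;
  lb_counitr : forall x, \swb_(x1 ⊗ x2 <- Δ x) t (ε x2) ∙ x1 = x;
  (* Δ is an algebra map into the Takeuchi product.  The factorwise product is
     only defined there, hence the quantification over all lifts to L ⊗ L. *)
  lb_takeuchi : forall x b,
    \swb_(x1 ⊗ x2 <- Δ x) (x1 ∙ t b) ⊙ x2 = \swb_(x1 ⊗ x2 <- Δ x) x1 ⊙ (x2 ∙ s b);
  lb_comul1 : Δ (tot_one D) = tot_one D ⊙ tot_one D;
  lb_comulM : forall x y (u v : L ⊗ L), bimod_class u = Δ x -> bimod_class v = Δ y ->
    Δ (x ∙ y) = \sw_(x1 ⊗ x2 <- u) \sw_(y1 ⊗ y2 <- v) (x1 ∙ y1) ⊙ (x2 ∙ y2);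
  lb_counit1 : ε (tot_one D) = base_one D;
  lb_counitM_src : forall x y, ε (x ∙ s (ε y)) = ε (x ∙ y);
  lb_counitM_tgt : forall x y, ε (x ∙ t (ε y)) = ε (x ∙ y)
}.

(* Bijectivity of x ⊗ y |-> x_(1) ⊗_B x_(2) y, where on the left
   x t(b) ⊗ y = x ⊗ t(b) y. *)
Definition is_left_hopf : Prop :=
  exists lam : {linear btensor (fun b x => x ∙ t b) (fun b y => t b ∙ y)
                  -> bimod_tensor (tot_mul D) s t},
    (forall x y, lam (btens _ _ x y) = \swb_(x1 ⊗ x2 <- Δ x) x1 ⊙ (x2 ∙ y)) /\
    bijective lam.

(* Bijectivity of x ⊗ y |-> x_(1) y ⊗_B x_(2), where on the left
   x s(b) ⊗ y = x ⊗ s(b) y. *)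
Definition is_anti_left_hopf : Prop :=
  exists mu : {linear btensor (fun b x => x ∙ s b) (fun b y => s b ∙ y)
                 -> bimod_tensor (tot_mul D) s t},
    (forall x y, mu (btens _ _ x y) = \swb_(x1 ⊗ x2 <- Δ x) (x1 ∙ y) ⊙ x2) /\
    bijective mu.

Record is_hopf_algebroid : Prop := IsHopfAlgebroid {
  ha_left_bialgebroid : is_left_bialgebroid;
  ha_left_hopf : is_left_hopf;
  ha_anti_left_hopf : is_anti_left_hopf
}.

End LeftBialgebroid.

Section ActionHopfAlgebroid.
Variables (k : fieldType) (H : hopfAlgType k) (B : lmodType k).
Variable D : dy_algebra_data H B.

(* g * h2 is the product of h2 and g in H^op. *)
Definition action_mul (x y : B ⊗ H) : B ⊗ H :=
  \sw_(a ⊗ h <- x) \sw_(b ⊗ g <- y) \sw_(h1 ⊗ h2 <- comul h)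
    dy_mul D a (dy_act D b h1) ⊗ (g * h2).
Definition action_src (a : B) : B ⊗ H := a ⊗ 1.
Definition action_tgt (a : B) : B ⊗ H := dy_coact D a.
Definition action_comul (x : B ⊗ H) : bimod_tensor action_mul action_src action_tgt :=
  \sw_(a ⊗ h <- x) \sw_(h1 ⊗ h2 <- comul h) btens _ _ (a ⊗ h1) (dy_one D ⊗ h2).
Definition action_counit (x : B ⊗ H) : B :=
  \sw_(a ⊗ h <- x) (counit h : k) *: a.

Definition action_bialgebroid : bialgebroid_data B (B ⊗ H)%type :=
  BialgebroidData (dy_mul D) (dy_one D) (dy_one D ⊗ 1)
    action_comul action_counit.

End ActionHopfAlgebroid.

Section Underline.
Variables (k : fieldType) (H : hopfAlgType k) (R : {linear (H ⊗ H)%type -> k^o}).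

Definition underline_mul (h g : H) : H :=
  \sw3_(h1 ⊗ h2 ⊗ h3 <- comul2 h) \sw3_(g1 ⊗ g2 ⊗ g3 <- comul2 g)
    (R (h3 ⊗ antipode g1) * R (h1 ⊗ g2) : k) *: (h2 * g3).
Definition underline_coact (h : H) : H ⊗ H :=
  \sw3_(h1 ⊗ h2 ⊗ h3 <- comul2 h) h2 ⊗ (antipode h1 * h3).
Definition underline_act (h g : H) : H :=
  \sw3_(h1 ⊗ h2 ⊗ h3 <- comul2 h) \sw_(g1 ⊗ g2 <- comul g)
    (R (g1 ⊗ h1) * R (h3 ⊗ g2) : k) *: h2.

Definition underline : dy_algebra_data H H :=
  DYAlgebraData underline_mul 1 underline_act underline_coact.

End Underline.

(* Main.v *)
Require Import Defs.
From mathcomp Require Import all_boot all_order all_algebra.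
From HB Require Import structures.
From mathcomp Require Import ring zify boolp.
Import GRing.Theory.
Local Open Scope ring_scope.
Set Implicit Arguments.
Unset Strict Implicit.
Unset Printing Implicit Defensive.

(** Write r(x, y) for R(x ⊗ y), h_1, h_2, ... for the legs of an iterated
    coproduct and a_(0) ⊗ a_(1) for Ad_R(a) = a_2 ⊗ S(a_1) a_3.

    Everything about the transmuted algebra follows from the crossing relation
    g_1 h_1 r(h_2, g_2) = r(h_1, g_1) h_2 g_2 ([rcross]): an r between two legs
    of two elements may pass over the product of the neighbouring legs, at the
    price of reversing that product.  With an antipode on one argument it
    becomes [rcross_Sl] and [rcross_Sr].  In the Drinfeld–Yetter condition and
    in the comodule algebra axiom one expands both sides into a single sum over
    the legs of each element, and two crossings carry one side to the other
    ([tact_ad_compat], [ad_tmul]).  The module algebra axiom is a Yang–Baxter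
    type computation of the same kind, where the crossed products stand inside
    an r ([tact_tmul]).  Since R is invariant under S ⊗ S ([rSS]), the product
    is a • b = a_(0) b_2 r(a_(1), S b_1) ([tmulE]); in this form associativity
    is the multiplicativity of the coaction ([tmulA]).  For braided
    commutativity, the sum b_(0) • (a ◁ b_(1)) contains two factors r that
    cancel against factors with an antipode, and one crossing turns what is left
    into a • b ([tmul_braided_comm]).

    The action Hopf algebroid exists for every braided-commutative algebra B
    over a Hopf algebra with bijective antipode ([action_hopf_algebroid]).
    Braided commutativity says that left multiplication by the target is
    t(b)(a # h) = a b_(0) # h b_(1) ([tgt_am]).  Hence source and target
    commute, and in L ⊗_B L, where L = B # H^op, each x ⊗ (b # g) equals
    t(b)x ⊗ (1 # g), so that maps out of L ⊗_B L are determined by their values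
    on the elements x ⊗ (1 # g) ([bal_of_pure]).  The Takeuchi property of the
    coproduct is the Drinfeld–Yetter condition ([takeuchi]).  The two Galois maps
    are inverted by
      (a # h) ⊗ (1 # g) |-> (a # h_1) ⊗ (1 # g S^-1(h_2)),
      (a # h) ⊗ (1 # g) |-> (a # g_2) ⊗ (1 # h S(g_1))
    ([lam_bij], [mu_bij]).

    The first of these needs S^-1, which a coquasitriangular Hopf algebra has:
    the functional u(c) = r(c_1, S c_2) is convolution invertible and conjugates S^2 into the
    identity ([drin_S2], [drin_mulV]), so that S^2 is bijective.

    Identities between iterated coproducts are dealt with once and for all by
    [swrun_eq]: a sum obtained by splitting given elements again and again
    depends only on how many legs each element ends up with, provided that the
    summand is linear in every leg. *)

(** * Linear maps and sums over tensors *)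

Lemma eq_tlift (k : fieldType) (V W U : lmodType k) (F G : V -> W -> U) t :
  (forall x y, F x y = G x y) -> tlift F t = tlift G t.
Proof. by move=> E; apply: eq_bigr => p _; rewrite E. Qed.

(** A head symbol of its own for linearity, which the syntax-directed tactic
    [lin] recognizes. *)
Definition islin (k : fieldType) (T U : lmodType k) (f : T -> U) : Prop := linear f.

Section Linear.
Variables (k : fieldType).
Implicit Types V W U T : lmodType k.

Lemma lin_id V : islin (fun x : V => x).
Proof. by []. Qed.

Lemma lin_comp V W U (g : W -> U) (f : V -> W) :
  islin g -> islin f -> islin (fun x => g (f x)).
Proof. by move=> lg lf a x y; rewrite lf lg. Qed.

Lemma lin_bil1 V W U T (g : W -> U -> T) (f : V -> W) y :
  bilinear_map g -> islin f -> islin (fun x => g (f x) y).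
Proof. by move=> [lg _] lf a x z; rewrite lf lg. Qed.

Lemma lin_bil2 V W U T (g : W -> U -> T) (f : V -> U) y :
  bilinear_map g -> islin f -> islin (fun x => g y (f x)).
Proof. by move=> [_ lg] lf a x z; rewrite lf lg. Qed.

Lemma lin_scale V W (c : k) (f : V -> W) :
  islin f -> islin (fun x => c *: f x).
Proof. by move=> lf a x y; rewrite lf scalerDr !scalerA mulrC. Qed.

Lemma lin_scalel V W (f : V -> k^o) (w : W) :
  islin f -> islin (fun x => (f x : k) *: w).
Proof. by move=> lf a x y; rewrite lf scalerDl scalerA. Qed.

Lemma lin_mull V (A : algType k) (f : V -> A) b :
  islin f -> islin (fun x => f x * b).
Proof. by move=> lf a x y; rewrite lf mulrDl scalerAl. Qed.

Lemma lin_mulr V (A : algType k) (f : V -> A) b :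
  islin f -> islin (fun x => b * f x).
Proof. by move=> lf a x y; rewrite lf mulrDr scalerAr. Qed.

Lemma lin_kmull V (f : V -> k^o) (b : k) :
  islin f -> islin (fun x => ((f x : k) * b) : k^o).
Proof. exact: (@lin_mull V k^o). Qed.

Lemma lin_kmulr V (f : V -> k^o) (b : k) :
  islin f -> islin (fun x => (b * (f x : k)) : k^o).
Proof. exact: (@lin_mulr V k^o). Qed.

Lemma lin_tlift V W U T (F : T -> V -> W -> U) t :
  (forall x y, islin (fun z => F z x y)) -> islin (fun z => tlift (F z) t).
Proof.
move=> lF a x y; rewrite /tlift scaler_sumr -big_split; apply: eq_bigr => p _ /=.
by rewrite lF scalerDr !scalerA mulrC.
Qed.

Lemma lin_blift V W U T (B : lmodType k) (r : B -> V -> V) (l : B -> W -> W)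
  (F : T -> V -> W -> U) (t : btensor r l) :
  (forall x y, islin (fun z => F z x y)) -> islin (fun z => blift (F z) t).
Proof. exact: lin_tlift. Qed.

Lemma lin_tliftr V W U T (F : V -> W -> U) (t : T -> (V ⊗ W)%type) :
  bilinear_map F -> islin t -> islin (fun z => tlift F (t z)).
Proof. by move=> bF; apply: lin_comp; apply: tlift_linear. Qed.

Lemma tlift_comp V W U T (L : U -> T) (F : V -> W -> U) t :
  islin L -> L (tlift F t) = tlift (fun x y => L (F x y)) t.
Proof.
move=> lL; pose g := GRing.isLinear.Build k U T _ L lL.
pose L' : {linear U -> T} := HB.pack L g.
by rewrite -[L]/(L' : U -> T) linear_sum; apply: eq_bigr => p _; rewrite linearZ.
Qed.

(** A finite double sum summed in either order. *)
Lemma tlift_swap V W V' W' U (F : V -> W -> V' -> W' -> U) t t' :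
  tlift (fun x y => tlift (F x y) t') t =
  tlift (fun x' y' => tlift (fun x y => F x y x' y') t) t'.
Proof.
rewrite /tlift; under eq_bigr do rewrite scaler_sumr.
rewrite exchange_big; apply: eq_bigr => q _; rewrite scaler_sumr.
by apply: eq_bigr => p _; rewrite !scalerA mulrC.
Qed.

Lemma lin_tens_l V W T (f : T -> V) (w : W) :
  islin f -> islin (fun x => f x ⊗ w).
Proof. exact: lin_bil1 (tens_bilinear _ _). Qed.

Lemma lin_tens_r V W T (f : T -> W) (v : V) :
  islin f -> islin (fun x => v ⊗ f x).
Proof. exact: lin_bil2 (tens_bilinear _ _). Qed.

End Linear.

(** * Sweedler sums and their regrouping *)

Section Hopf.
Variables (k : fieldType) (H : hopfAlgType k).
Implicit Types U T : lmodType k.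

(** The structure maps as plain functions to vector spaces, so that they can be
    composed with the lemmas on [islin]. *)
Definition cop (c : H) : H ⊗ H := comul c.
Definition eps (c : H) : k^o := counit c.
Definition S (c : H) : H := antipode c.

Lemma lin_cop : islin cop.
Proof. exact: (linearP (@comul k H)). Qed.
Lemma lin_eps : islin eps.
Proof. exact: (linearP (@counit k H)). Qed.
Lemma lin_S : islin S.
Proof. exact: (linearP (@antipode k H)). Qed.

Definition sw2 U (c : H) (F : H -> H -> U) : U := tlift F (cop c).

Lemma copA (c : H) :
  \sw_(c1 ⊗ c2 <- cop c) cop c1 ⊗ c2 =
  \sw_(c1 ⊗ c2 <- cop c) \sw_(d1 ⊗ d2 <- cop c2) (c1 ⊗ d1) ⊗ d2.
Proof. exact: (comulA (c : H)). Qed.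

Lemma eps_l (c : H) : sw2 c (fun x y => (eps x : k) *: y) = c.
Proof. exact: (counitl (c : H)). Qed.

Lemma eps_r (c : H) : sw2 c (fun x y => (eps y : k) *: x) = c.
Proof. exact: (counitr (c : H)). Qed.

Lemma eq_sw2 U c (F G : H -> H -> U) :
  (forall x y, F x y = G x y) -> sw2 c F = sw2 c G.
Proof. exact: eq_tlift. Qed.

Lemma lin_sw2 U T (F : T -> H -> H -> U) c :
  (forall x y, islin (fun z => F z x y)) -> islin (fun z => sw2 c (F z)).
Proof. exact: lin_tlift. Qed.

Lemma lin_sw2r U T (F : H -> H -> U) (c : T -> H) :
  bilinear_map F -> islin c -> islin (fun z => sw2 (c z) F).
Proof. by move=> bF lc; apply: lin_tliftr => //; apply: (lin_comp lin_cop). Qed.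

Lemma sw2_comp U T (L : U -> T) (F : H -> H -> U) c :
  islin L -> L (sw2 c F) = sw2 c (fun x y => L (F x y)).
Proof. exact: tlift_comp. Qed.

Lemma sw2_swap U (F : H -> H -> H -> H -> U) c d :
  sw2 c (fun x y => sw2 d (F x y)) = sw2 d (fun x' y' => sw2 c (fun x y => F x y x' y')).
Proof. exact: tlift_swap. Qed.

(** Coassociativity under a trilinear map: it is the image of the equation
    between tensors under the linear map that the trilinear map induces. *)
Lemma sw2A U (F : H -> H -> H -> U) c :
  (forall y z, islin (fun x => F x y z)) -> (forall x z, islin (fun y => F x y z)) ->
  (forall x y, islin (F x y)) ->
  sw2 c (fun x y => sw2 x (fun u v => F u v y)) =
  sw2 c (fun u t => sw2 t (fun v y => F u v y)).
Proof.
move=> l1 l2 l3; have := copA c.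
have bF z : bilinear_map (fun x y => F x y z) by split=> *; [apply: l1 | apply: l2].
pose G := fun (xy : (H ⊗ H)%type) (z : H) => tlift (fun x y => F x y z) xy.
have bG : bilinear_map G.
  by split=> [z|xy]; [apply: tlift_linear | apply: lin_tlift].
have lG : islin (tlift G) by apply: tlift_linear.
move=> /(congr1 (tlift G)) e.
have {e}e := etrans (esym (tlift_comp _ _ lG)) (etrans e (tlift_comp _ _ lG)).
transitivity (tlift (fun c1 c2 => tlift G (cop c1 ⊗ c2)) (cop c)).
  by apply: eq_tlift => x y; apply/esym/tlift_tens.
apply: (etrans e); apply: eq_tlift => x y.
apply: (etrans (tlift_comp _ _ lG)); apply: eq_tlift => u v.
by apply: (etrans (tlift_tens _ _ bG)); apply: tlift_tens.
Qed.

Lemma sw2_counitl U (L : H -> U) c :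
  islin L -> sw2 c (fun x y => (eps x : k) *: L y) = L c.
Proof.
move=> lL; rewrite -{2}[c]eps_l (sw2_comp _ _ lL); apply: eq_sw2 => x y.
by rewrite (GRing.scalable_linear lL).
Qed.

Lemma sw2_counitr U (L : H -> U) c :
  islin L -> sw2 c (fun x y => (eps y : k) *: L x) = L c.
Proof.
move=> lL; rewrite -{2}[c]eps_r (sw2_comp _ _ lL); apply: eq_sw2 => x y.
by rewrite (GRing.scalable_linear lL).
Qed.

(** [swrun p e F] splits the entries of the list [e] one after the other:
    each number in [p] is the position, in the current list of legs, of the leg
    that is replaced by the two legs of its coproduct.  At the end [F] is applied
    to the list of all legs. *)
Fixpoint swrun U (p : seq nat) (e : seq H) (F : seq H -> U) : U :=
  if p is i :: p' then
    sw2 (nth 0 e i) (fun a b => swrun p' (take i e ++ a :: b :: drop i.+1 e) F)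
  else F e.

(** The normal form of an iterated coproduct: [x] is split into [n.+1] legs by
    splitting the last leg each time; [comb] does this to each entry of a list. *)
Fixpoint comb1 U n x (K : seq H -> U) : U :=
  if n is m.+1 then sw2 x (fun a t => comb1 m t (fun l => K (a :: l))) else K [:: x].

Fixpoint comb U (cs : seq nat) (e : seq H) (F : seq H -> U) : U :=
  match cs, e with
  | c :: cs', x :: e' => comb1 c x (fun l => comb cs' e' (fun l' => F (l ++ l')))
  | _, _ => F [::]
  end.

(** How often each of the [n] initial entries is split, directly or through its
    legs, when [p] is run. *)
Fixpoint swlegs (p : seq nat) (n : nat) : seq nat :=
  if p is i :: p' then
    let cs := swlegs p' n.+1 in
    take i cs ++ (nth 0 cs i + nth 0 cs i.+1).+1%N :: drop i.+2 cs
  else nseq n 0%N.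

Fixpoint swok (p : seq nat) (n : nat) : bool :=
  if p is i :: p' then (i < n)%N && swok p' n.+1 else true.

Definition mlin U n (F : seq H -> U) : Prop :=
  forall l1 l2 : seq H, (size l1 + size l2).+1 = n -> islin (fun x => F (l1 ++ x :: l2)).

(** [mlinc] is [mlin] in a form that unfolds, for a numeral [n], to quantified
    statements about [n] named variables. *)
Fixpoint forall_seq n (P : seq H -> Prop) : Prop :=
  if n is m.+1 then forall x, forall_seq m (fun l => P (x :: l)) else P [::].

Fixpoint mlinc U n (F : seq H -> U) : Prop :=
  if n is m.+1 then forall_seq m (fun l => islin (fun x => F (x :: l))) /\
    forall x, mlinc m (fun l => F (x :: l))
  else True.

Lemma forall_seqP n P l : forall_seq n P -> size l = n -> P l.
Proof.
elim: n P l => [|n IH] P [|x l] //= h [sl].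
exact: (IH (fun l => P (x :: l)) l (h x) sl).
Qed.

Lemma mlincP U n (F : seq H -> U) : mlinc n F -> mlin n F.
Proof.
elim: n F => [|n IH] F; first by move=> _ l1 l2.
move=> /= [h1 h2] [|x l1] l2 /= [h]; first exact: (forall_seqP h1).
by apply: (IH (fun l => F (x :: l))).
Qed.

Lemma mlin_cons U n (F : seq H -> U) x : mlin n.+1 F -> mlin n (fun l => F (x :: l)).
Proof. by move=> h l1 l2 e; apply: (h (x :: l1)); rewrite /= -e. Qed.

Lemma mlin_cat U n m (F : seq H -> U) l : size l = m -> mlin (m + n) F ->
  mlin n (fun l' => F (l ++ l')).
Proof.
elim: l m F => [|x l IH] [|m] F //= [e] h.
by apply: (IH m (fun l => F (x :: l)) e); apply: mlin_cons.
Qed.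

Lemma eq_comb1 U n x (K K' : seq H -> U) :
  (forall l, size l = n.+1 -> K l = K' l) -> comb1 n x K = comb1 n x K'.
Proof.
elim: n x K K' => [|n IH] x K K' e /=; first exact: e.
by apply: eq_sw2 => a t; apply: IH => l s; apply: e; rewrite /= s.
Qed.

Lemma lin_comb1 U T n x (K : T -> seq H -> U) :
  (forall l, size l = n.+1 -> islin (fun z => K z l)) -> islin (fun z => comb1 n x (K z)).
Proof.
elim: n x K => [|n IH] x K lK /=; first exact: lK.
by apply: lin_sw2 => a t; apply: IH => l s; apply: lK; rewrite /= s.
Qed.

Lemma lin_comb1r U n (K : seq H -> U) : mlin n.+1 K -> islin (fun x => comb1 n x K).
Proof.
elim: n K => [|n IH] K lK /=; first exact: (lK [::] [::]).
apply: lin_sw2r; last exact: lin_id.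
split=> [y|x]; last by apply: IH; apply: mlin_cons.
by apply: lin_comb1 => l s; apply: (lK [::]); rewrite /= s.
Qed.

Lemma lin_comb U T cs e (F : T -> seq H -> U) : size cs = size e ->
  (forall l, size l = (sumn cs + size e)%N -> islin (fun z => F z l)) ->
  islin (fun z => comb cs e (F z)).
Proof.
elim: cs e F => [|c cs IH] [|x e] F //= => [_ lF|[s] lF]; first exact: lF.
apply: lin_comb1 => l sl; apply: IH => // l' sl'; apply: lF.
by rewrite size_cat sl sl'; lia.
Qed.

Lemma comb1_swap U n x c (F : H -> H -> seq H -> U) :
  sw2 c (fun a b => comb1 n x (F a b)) =
  comb1 n x (fun l => sw2 c (fun a b => F a b l)).
Proof.
elim: n x F => [|n IH] x F //=.
by rewrite sw2_swap; apply: eq_sw2 => a t; rewrite IH.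
Qed.

(** Generalized coassociativity for a single element, by induction from [sw2A]. *)
Lemma comb1_cat U m n x (K : seq H -> U) : mlin (m + n).+2 K ->
  sw2 x (fun a b => comb1 m a (fun l => comb1 n b (fun l' => K (l ++ l')))) =
  comb1 (m + n).+1 x K.
Proof.
elim: m x K => [|m IH] x K lK //=.
rewrite (sw2A (F := fun a1 t b => comb1 m t (fun l => comb1 n b (fun l' =>
  K (a1 :: l ++ l'))))) /=.
- apply: eq_sw2 => a t; apply: (IH t (fun l => K (a :: l))).
  exact: mlin_cons.
- move=> y z; apply: lin_comb1 => l sl; apply: lin_comb1 => l' sl'.
  by apply: (lK [::] (l ++ l')); rewrite /= size_cat sl sl'; lia.
- move=> a z; apply: lin_comb1r => l1 l2 s; apply: lin_comb1 => l' sl'.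
  have := lK (a :: l1) (l2 ++ l').
  rewrite /= size_cat sl' => h b u v; rewrite -!catA; apply: h; lia.
- move=> a t; apply: lin_comb1 => l sl; apply: lin_comb1r => l1 l2 s z x0 y0.
  have := lK ((a :: l) ++ l1) l2.
  rewrite size_cat /= sl => h.
  by have := h _ z x0 y0; rewrite /= -!catA; apply; lia.
Qed.

(** If each leg of a split entry [x] is further split in normal form, then [x] as
    a whole can be split in normal form.  This is the step that normalizes
    [swrun] from its last split to its first. *)
Lemma comb_merge U c1 m n c2 e1 x e2 (F : seq H -> U) :
  size c1 = size e1 -> size c2 = size e2 ->
  mlin (sumn (c1 ++ (m + n).+1 :: c2) + size (e1 ++ x :: e2)) F ->
  sw2 x (fun a b => comb (c1 ++ m :: n :: c2) (e1 ++ a :: b :: e2) F) =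
  comb (c1 ++ (m + n).+1%N :: c2) (e1 ++ x :: e2) F.
Proof.
elim: c1 e1 F => [|c c1 IH] [|y e1] F //=.
  move=> _ s2 lF; pose K l0 := comb c2 e2 (fun l => F (l0 ++ l)).
  transitivity (sw2 x (fun a b =>
    comb1 m a (fun l => comb1 n b (fun l' => K (l ++ l'))))).
    apply: eq_sw2 => a b; apply: eq_comb1 => l _ /=; apply: eq_comb1 => l' _.
    by congr (comb _ _ _); apply/funext => l''; rewrite catA.
  apply: comb1_cat => l1 l2 s; apply: lin_comb => // l sl a u v.
  by rewrite -!catA; apply: (lF l1 (l2 ++ l)); rewrite size_cat sl; lia.
move=> [s1] s2 lF; rewrite comb1_swap; apply: eq_comb1 => l sl.
apply: (IH e1 (fun l' => F (l ++ l'))) => //; apply: (mlin_cat sl).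
by congr (mlin _ F) : lF; lia.
Qed.

Lemma size_swlegs p n : swok p n -> size (swlegs p n) = n.
Proof.
elim: p n => [|i p IH] n /=; first by rewrite size_nseq.
move=> /andP[lin ok]; rewrite size_cat /= size_take size_drop IH //.
by rewrite ltnS (ltnW lin); lia.
Qed.

Lemma nth_split2 (cs : seq nat) i : (i.+1 < size cs)%N ->
  cs = take i cs ++ nth 0%N cs i :: nth 0%N cs i.+1 :: drop i.+2 cs.
Proof.
move=> lt; rewrite -[LHS](cat_take_drop i); congr (_ ++ _).
by rewrite (drop_nth 0%N) ?(ltnW lt) // (drop_nth 0%N).
Qed.

Lemma sumn_swlegs p n : swok p n -> sumn (swlegs p n) = size p.
Proof.
elim: p n => [|i p IH] n /=; first by rewrite sumn_nseq.
move=> /andP[lin ok]; rewrite -(IH _ ok).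
rewrite [in RHS](@nth_split2 (swlegs p n.+1) i) ?size_swlegs //.
by rewrite !sumn_cat /=; lia.
Qed.

Lemma swrunE U p e (F : seq H -> U) :
  swok p (size e) -> mlin (size e + size p) F ->
  swrun p e F = comb (swlegs p (size e)) e F.
Proof.
elim: p e F => [|i p IH] e F /=.
  move=> _ _; elim: e F => [|x e IHe] F //=.
  by rewrite -IHe.
move=> /andP[lin ok]; set x := nth 0 e i; set cs := swlegs p _ => lF.
have scs : size cs = (size e).+1 by rewrite size_swlegs.
have se a b : size (take i e ++ a :: b :: drop i.+1 e) = (size e).+1.
  by rewrite size_cat /= size_take lin size_drop; lia.
transitivity (sw2 x (fun a b => comb cs (take i e ++ a :: b :: drop i.+1 e) F)).
  apply: eq_sw2 => a b; rewrite IH se //.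
  by move: lF; rewrite addnS addSn.
rewrite {1}(@nth_split2 cs i) ?scs // comb_merge.
- by rewrite -drop_nth // cat_take_drop.
- by rewrite !size_take scs lin ltnS (ltnW lin).
- by rewrite !size_drop scs; lia.
- have := sumn_swlegs ok; rewrite -/cs {1}(@nth_split2 cs i) ?scs //.
  move=> es; congr (mlin _ F) : lF; move: es; rewrite !sumn_cat size_cat /=.
  by rewrite size_take lin size_drop; lia.
Qed.

(** General coassociativity: the legs of one element come in a definite order,
    and splitting different elements commutes, so that two programs which give
    each element the same number of legs yield the same sum. *)
Lemma swrun_eq U (p q : seq nat) e (F : seq H -> U) :
  [&& swok p (size e), swok q (size e) & swlegs p (size e) == swlegs q (size e)] ->
  mlinc (size e + size p) F -> swrun p e F = swrun q e F.
Proof.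
move=> /and3P[okp okq /eqP epq] /mlincP lF; rewrite !swrunE ?epq //.
by rewrite -(sumn_swlegs okq) -epq sumn_swlegs.
Qed.
End Hopf.

(** * Tactics for linearity and regrouping *)

Lemma bilinI (k : fieldType) (V W U : lmodType k) (f : V -> W -> U) :
  (forall y, islin (fun x => f x y)) -> (forall x, islin (fun y => f x y)) ->
  bilinear_map f.
Proof. by []. Qed.

Section HopfLin.
Variables (k : fieldType) (H : hopfAlgType k) (T : lmodType k).

Lemma lin_mulHl (f : T -> H) (b : H) : islin f -> islin (fun x => f x * b).
Proof. exact: (@lin_mull k T H). Qed.
Lemma lin_mulHr (f : T -> H) (b : H) : islin f -> islin (fun x => b * f x).
Proof. exact: (@lin_mulr k T H). Qed.
Lemma lin_SH (f : T -> H) : islin f -> islin (fun x => S (f x)).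
Proof. exact: (lin_comp (@lin_S k H)). Qed.
Lemma lin_epsH (f : T -> H) : islin f -> islin (fun x => eps (f x)).
Proof. exact: (lin_comp (@lin_eps k H)). Qed.
Lemma lin_copH (f : T -> H) : islin f -> islin (fun x => cop (f x)).
Proof. exact: (lin_comp (@lin_cop k H)). Qed.

End HopfLin.

(** Decides linearity and bilinearity by recursion on the body of the function.
    The variable occurs in one argument of each operation, which the patterns
    [fun _ => _] detect; unknown operations are looked up in the context. *)
Ltac lin :=
  cbv beta;
  lazymatch goal with
  | |- True => exact I
  | |- @eq _ _ _ => fail
  | |- _ /\ _ => split; lin
  | |- forall _, _ => intro; lin
  | |- bilinear_map _ =>
      first [ match goal with
              h : @bilinear_map _ _ _ _ ?g |- @bilinear_map _ _ _ _ ?g' =>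
                constr_eq g g'; exact h end
            | apply: bilinI; intro; lin ]
  | |- @islin _ ?T _ (fun x => x) => refine (@lin_id _ T)
  | |- @islin ?k ?T ?U (fun x => @sw2 _ ?H _ (@?c x) (@?F x)) =>
      lazymatch c with
      | (fun _ => ?c') => refine (@lin_sw2 k H U T F c' _); intros; lin
      | _ => lazymatch F with
             (fun _ => ?F') => refine (@lin_sw2r k H U T F' c _ _); lin end
      end
  | |- @islin ?k ?T ?U (fun x => @tlift _ ?V ?W _ (@?F x) (@?c x)) =>
      lazymatch c with
      | (fun _ => ?c') => refine (@lin_tlift k V W U T F c' _); intros; lin
      | _ => lazymatch F with
             (fun _ => ?F') => refine (@lin_tliftr k V W U T F' c _ _); lin end
      end
  | |- @islin ?k ?T ?U (fun x => @blift _ ?B ?V ?W ?r ?l _ (@?F x) (@?c x)) =>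
      lazymatch c with
      | (fun _ => ?c') => refine (@lin_blift k V W U T B r l F c' _); intros; lin
      | _ => lin_hyp
      end
  | |- @islin ?k ?T _ (fun x => @tens _ ?V ?W (@?f x) (@?g x)) =>
      lazymatch g with
      | (fun _ => ?w) => refine (@lin_tens_l k V W T f w _); lin
      | _ => lazymatch f with
             (fun _ => ?w) => refine (@lin_tens_r k V W T g w _); lin end
      end
  | |- @islin ?k ?T ?U (fun x => @GRing.scale _ _ (@?f x) (@?g x)) =>
      lazymatch f with
      | (fun _ => ?w) => refine (@lin_scale k T U w g _); lin
      | _ => lazymatch g with
             (fun _ => ?w) => refine (@lin_scalel k T U f w _); lin end
      end
  | |- @islin ?k ?T ?U (fun x => @GRing.mul _ (@?f x) (@?g x)) =>
      lazymatch g with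
      | (fun _ => ?w) =>
        first [ refine (@lin_kmull k T f w _)
              | match goal with H : Hopf.type k |- _ => refine (@lin_mulHl k H T f w _) end ]
      | _ => lazymatch f with (fun _ => ?w) =>
        first [ refine (@lin_kmulr k T g w _)
              | match goal with H : Hopf.type k |- _ => refine (@lin_mulHr k H T g w _) end ]
        end
      end; lin
  | |- @islin ?k ?T _ (fun x => @S _ ?H (@?f x)) =>
      refine (@lin_SH k H T f _); lin
  | |- @islin ?k ?T _ (fun x => @eps _ ?H (@?f x)) =>
      refine (@lin_epsH k H T f _); lin
  | |- @islin ?k ?T _ (fun x => @cop _ ?H (@?f x)) =>
      refine (@lin_copH k H T f _); lin
  | |- @islin _ _ _ (@tens ?k ?V ?W ?w) => exact (proj2 (tens_bilinear V W) w)
  | |- @islin ?k ?T _ (@GRing.mul _ ?w) =>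
      first [ match goal with H : Hopf.type k |- _ =>
                exact (@lin_mulHr k H H (fun x => x) w (@lin_id k H)) end
            | exact (@lin_kmulr k T (fun x => x) w (@lin_id k T)) ]
  | |- @islin ?k ?T _ (@GRing.scale _ _ ?w) =>
      exact (@lin_scale k T T w (fun x => x) (@lin_id k T))
  | |- @islin _ _ _ (@tlift ?k ?V ?W ?U ?F) =>
      refine (@tlift_linear k V W U F _); lin
  | |- @islin _ _ _ (@S ?k ?H) => exact (@lin_S k H)
  | |- @islin _ _ _ (@eps ?k ?H) => exact (@lin_eps k H)
  | |- @islin _ _ _ (@cop ?k ?H) => exact (@lin_cop k H)
  | |- _ => first [ lin_hyp | lin_homo ]
  end
with lin_homo :=
  match goal with
  | h : forall f _ _, islin f -> islin _ |- _ => solve [apply: h; lin]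
  | h : forall T f _ _, islin f -> islin _ |- _ => solve [apply: h; lin]
  end
with lin_hyp :=
  lazymatch goal with
  | |- @islin _ ?T _ (fun x => ?g (@?f x) (@?f' x)) =>
    match goal with
    | h : @bilinear_map ?k ?V ?W ?U g |- _ =>
      lazymatch f' with
      | (fun _ => ?w) => refine (@lin_bil1 k T V W U g f w h _); lin
      | _ => lazymatch f with (fun _ => ?w) => refine (@lin_bil2 k T V W U g f' w h _); lin end
      end
    end
  | |- @islin _ ?T _ (fun x => ?g (@?f x)) =>
    match goal with
    | h : @islin ?k ?V ?W g |- _ => refine (@lin_comp k T V W g f h _); lin
    end
  | |- @islin _ _ _ (?g ?w) =>
    match goal with
    | h : @bilinear_map _ _ _ _ g |- _ => exact (proj2 h w)
    end
  | |- @islin _ _ _ ?g =>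
    match goal with h : @islin _ _ _ ?g' |- _ => constr_eq g g'; exact h end
  end.

Ltac sw_index x e :=
  lazymatch e with
  | x :: _ => constr:(0%N)
  | _ :: ?e' => let r := sw_index x e' in
      lazymatch r with None => r | _ => constr:(r.+1) end
  | _ => constr:(@None nat)
  end.
Ltac sw_splice e i a b :=
  lazymatch i with
  | 0%N => lazymatch e with _ :: ?e' => constr:(a :: b :: e') end
  | ?j.+1 => lazymatch e with ?x :: ?e' =>
      let e'' := sw_splice e' j a b in constr:(x :: e'') end
  end.
Ltac sw_abstract T E e :=
  lazymatch e with
  | ?x :: ?e' =>
      let E' := sw_abstract T E e' in
      lazymatch eval pattern x in E' with ?f _ => constr:(f) end
  | _ => constr:(E)
  end.
(** Reads off the program and the summand of an iterated sum: the program is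
    accumulated in reverse in [acc], [e] is the current list of legs, and the
    results instantiate the evars [p] and [F]. *)
Ltac sw_descend e acc p F :=
  cbv beta;
  lazymatch goal with
  | |- @sw2 ?k ?T ?U ?x ?E = _ =>
      let i := sw_index x e in
      lazymatch i with
      | None => sw_leaf e acc p F
      | _ =>
        refine (@eq_sw2 k T U x E E _);
        let a := fresh "a" in let b := fresh "b" in
        intros a b;
        let e' := sw_splice e i a b in
        sw_descend e' constr:(i :: acc) p F
      end
  | |- _ => sw_leaf e acc p F
  end
with sw_leaf e acc p F :=
  lazymatch goal with
  | |- ?E = _ =>
    let q := eval cbv in (rev acc) in
    lazymatch type of e with
    | list ?T =>
      let f := sw_abstract T E e in
      let g := constr:(fun l : seq T =>
        ltac:(let t := sw_appl f T l 0%N e in exact t)) in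
      let g' := eval cbv beta in g in
      unify p q; unify F g'; reflexivity
    end
  end
with sw_appl f T l n e :=
  lazymatch e with
  | _ :: ?e' =>
     let g := constr:(f (nth (0 : T) l n)) in sw_appl g T l constr:(n.+1) e'
  | _ => constr:(f)
  end.

Ltac sw_red := cbv beta iota delta [swrun nth take drop cat].

Ltac sw_mlin :=
  lazymatch goal with
  | |- @mlinc ?k ?T ?U ?n ?F => let n' := eval compute in n in
      change (@mlinc k T U n' F); cbv beta iota delta [mlinc forall_seq nth]; lin
  end.

Ltac sw_core e q :=
  lazymatch goal with
  | |- @eq ?UT ?X ?Y =>
    lazymatch X with @sw2 ?k ?T ?U _ _ =>
    let p := fresh "p" in let F := fresh "F" in
    evar (p : seq nat); evar (F : seq (Hopf.sort T) -> GRing.Lmodule.sort U);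
    let hX := fresh in
    assert (hX : X = X);
    [ let p' := eval unfold p in p in let F' := eval unfold F in F in
      sw_descend e constr:(@nil nat) p' F'
    | clear hX;
      let p' := eval unfold p in p in let F' := eval unfold F in F in
      clear p F;
      change (@swrun k T U p' e F' = Y);
      refine (@etrans _ _ _ _ (@swrun_eq k T U p' q e F' isT _) _);
      [ sw_mlin | sw_red ] ]
    end
  end.
(** [sw e q] splits the entries of [e] according to the program [q] (see [swrun])
    instead of the way they are split on the left-hand side of the goal, by
    [swrun_eq]; [swr] does so on the right-hand side.  The last positions in [q]
    usually split the elements to which the next identity applies. *)
Tactic Notation "sw" constr(e) constr(q) := sw_core e q.
Tactic Notation "swr" constr(e) constr(q) := symmetry; sw_core e q; symmetry.

(** * The antipode *)

Section HopfTheory.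
Variables (k : fieldType) (H : hopfAlgType k).
Implicit Types U V W : lmodType k.

Lemma islinZ V W (f : V -> W) c x : islin f -> f (c *: x) = c *: f x.
Proof. by move=> lf; rewrite (GRing.scalable_linear lf). Qed.

Lemma tensZl V W c (x : V) (y : W) : (c *: x) ⊗ y = c *: (x ⊗ y).
Proof. by apply: (@islinZ V _ (fun x => x ⊗ y)); lin. Qed.

Lemma tensZr V W c (x : V) (y : W) : x ⊗ (c *: y) = c *: (x ⊗ y).
Proof. by apply: (@islinZ W _ (fun y => x ⊗ y)); lin. Qed.

Lemma sw2_mul U (F : H -> H -> U) (h g : H) : bilinear_map F ->
  sw2 (h * g) F = sw2 h (fun h1 h2 => sw2 g (fun g1 g2 => F (h1 * g1) (h2 * g2))).
Proof.
move=> bF; have lF : islin (tlift F) by apply: tlift_linear.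
have e : cop (h * g) = sw2 h (fun h1 h2 => sw2 g (fun g1 g2 =>
  (h1 * g1) ⊗ (h2 * g2))) by exact: (comulM h g).
rewrite {1}/sw2 e (sw2_comp _ _ lF); apply: eq_sw2 => h1 h2.
by rewrite (sw2_comp _ _ lF); apply: eq_sw2 => g1 g2; apply: tlift_tens.
Qed.

Lemma sw2_1 U (F : H -> H -> U) : bilinear_map F -> sw2 1 F = F 1 1.
Proof.
move=> bF; have e : cop 1 = (1 : H) ⊗ (1 : H) by exact: comul1.
by rewrite /sw2 e; apply: tlift_tens.
Qed.

Lemma eps1 : eps (1 : H) = 1. Proof. exact: counit1. Qed.
Lemma epsM (h g : H) : eps (h * g) = (eps h : k) * eps g.
Proof. exact: (counitM h g). Qed.

Lemma Sl U (L : H -> U) h : islin L ->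
  sw2 h (fun a b => L (S a * b)) = (eps h : k) *: L 1.
Proof.
move=> lL; rewrite -(islinZ _ _ lL) -(sw2_comp _ _ lL); congr L.
exact: (antipodel h).
Qed.

Lemma Sr U (L : H -> U) h : islin L ->
  sw2 h (fun a b => L (a * S b)) = (eps h : k) *: L 1.
Proof.
move=> lL; rewrite -(islinZ _ _ lL) -(sw2_comp _ _ lL); congr L.
exact: (antipoder h).
Qed.

Lemma Sl_l U (F : H -> H -> U) y : bilinear_map F ->
  sw2 y (fun x b => sw2 x (fun u v => F (S u * v) b)) = F 1 y.
Proof.
move=> bF; transitivity (sw2 y (fun x b => (eps x : k) *: F 1 b)).
  by apply: eq_sw2 => x b; apply: (@Sl _ (fun z => F z b)); lin.
by apply: (@sw2_counitl _ _ _ (F 1)); lin.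
Qed.

Lemma Sr_l U (F : H -> H -> U) y : bilinear_map F ->
  sw2 y (fun x b => sw2 x (fun u v => F (u * S v) b)) = F 1 y.
Proof.
move=> bF; transitivity (sw2 y (fun x b => (eps x : k) *: F 1 b)).
  by apply: eq_sw2 => x b; apply: (@Sr _ (fun z => F z b)); lin.
by apply: (@sw2_counitl _ _ _ (F 1)); lin.
Qed.

Lemma Sl_r U (F : H -> H -> U) y : bilinear_map F ->
  sw2 y (fun b x => sw2 x (fun u v => F b (S u * v))) = F y 1.
Proof.
move=> bF; transitivity (sw2 y (fun b x => (eps x : k) *: F b 1)).
  by apply: eq_sw2 => b x; apply: (@Sl _ (fun z => F b z)); lin.
by apply: (@sw2_counitr _ _ _ (fun b => F b 1)); lin.
Qed.

Lemma Sr_r U (F : H -> H -> U) y : bilinear_map F ->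
  sw2 y (fun b x => sw2 x (fun u v => F b (u * S v))) = F y 1.
Proof.
move=> bF; transitivity (sw2 y (fun b x => (eps x : k) *: F b 1)).
  by apply: eq_sw2 => b x; apply: (@Sr _ (fun z => F b z)); lin.
by apply: (@sw2_counitr _ _ _ (fun b => F b 1)); lin.
Qed.

Lemma S1 : S (1 : H) = 1.
Proof.
have := @Sl H (fun x => x) 1 (@lin_id _ H).
by rewrite eps1 scale1r sw2_1 ?mulr1 //; lin.
Qed.

Lemma epsS (h : H) : eps (S h) = eps h.
Proof.
have := @Sl _ (@eps k H) h (@lin_eps k H); rewrite eps1.
rewrite /GRing.scale /= mulr1 => <-.
rewrite -{1}[h](eps_r h) (sw2_comp _ _ (@lin_S k H)) (sw2_comp _ _ (@lin_eps k H)).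
apply: eq_sw2 => a b; rewrite epsM mulrC.
by rewrite (islinZ _ _ (@lin_S k H)) (islinZ _ _ (@lin_eps k H)).
Qed.

(** The antipode is antimultiplicative since S(hg) and S(g) S(h) are both
    convolution inverses of the product: E below is their product with h g in
    between, and it collapses to either of them. *)
Lemma SM (h g : H) : S (h * g) = S g * S h.
Proof.
pose E := sw2 h (fun h1 t => sw2 t (fun h2 h3 => sw2 g (fun g1 t =>
  sw2 t (fun g2 g3 => S (h1 * g1) * (h2 * (g2 * S g3) * S h3))))).
transitivity E; rewrite /E.
  rewrite -[LHS]mulr1 -(@Sr_r _ (fun h1 x => S (h1 * g) * x)); last by lin.
  apply: eq_sw2 => h1 t; apply: eq_sw2 => h2 h3.
  rewrite (@Sr_r _ (fun g1 x => S (h1 * g1) * (h2 * x * S h3))); last by lin.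
  by rewrite mulr1.
sw [:: h; g] [:: 0; 2; 0; 3]%N.
transitivity (sw2 h (fun x h3 => sw2 g (fun y g3 =>
  (eps x * eps y : k) *: (S g3 * S h3)))).
  apply: eq_sw2 => x h3; apply: eq_sw2 => y g3; rewrite -epsM.
  rewrite -[S g3 * S h3]mul1r -(@Sl _ (fun z => z * (S g3 * S h3))); last by lin.
  rewrite sw2_mul; last by lin.
  by apply: eq_sw2 => h1 h2; apply: eq_sw2 => g1 g2; rewrite !mulrA.
transitivity (sw2 h (fun x h3 => (eps x : k) *: (S g * S h3))).
  apply: eq_sw2 => x h3; rewrite -(@sw2_counitl _ _ _ (fun g => S g * S h3)); last by lin.
  rewrite (@sw2_comp _ _ _ _ (fun z => (eps x : k) *: z)); last by lin.
  by apply: eq_sw2 => y g3; rewrite scalerA.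
by rewrite (@sw2_counitl _ _ _ (fun h => S g * S h)); last by lin.
Qed.

(** The antipode is anticomultiplicative, by the same argument as in [SM], with
    the coproduct in place of the product. *)
Lemma sw2_S U (F : H -> H -> U) h : bilinear_map F ->
  sw2 (S h) F = sw2 h (fun a b => F (S b) (S a)).
Proof.
move=> bF.
pose E := sw2 h (fun h1 t => sw2 t (fun h2 t => sw2 t (fun h3 t => sw2 t (fun h4 h5 =>
  sw2 (S h1) (fun a b => F (a * (h2 * S h5)) (b * (h3 * S h4))))))).
transitivity E; rewrite /E.
  swr [:: h] [:: 0; 1; 1; 2]%N.
  transitivity (sw2 h (fun h1 t => sw2 t (fun y h5 =>
     sw2 (S h1) (fun a b => F (a * (y * S h5)) b)))).
    rewrite (@Sr_r _ (fun h1 x => sw2 (S h1) (fun a b => F (a * x) b))); last by lin.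
    by apply: eq_sw2 => a b; rewrite mulr1.
  apply: eq_sw2 => h1 t; apply: eq_sw2 => y h5.
  rewrite (@Sr_r _ (fun h2 x => sw2 (S h1) (fun a b => F (a * (h2 * S h5)) (b * x)))).
    by apply: eq_sw2 => a b; rewrite mulr1.
  by lin.
sw [:: h] [:: 0; 1; 0; 1]%N.
transitivity (sw2 h (fun x t => (eps x : k) *: sw2 t (fun a b => F (S b) (S a)))).
  apply: eq_sw2 => x t.
  rewrite (@sw2_comp _ _ _ _ (fun z => (eps x : k) *: z)); last by lin.
  apply: eq_sw2 => h4 h5.
  transitivity ((eps x : k) *: sw2 1 (fun a b => F (a * S h5) (b * S h4))).
    rewrite -(@Sl _ (fun z => sw2 z (fun a b => F (a * S h5) (b * S h4)))); last by lin.
    apply: eq_sw2 => h1 y; rewrite sw2_mul; last by lin.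
    rewrite sw2_swap; apply: eq_sw2 => a b; apply: eq_sw2 => c d.
    by rewrite !mulrA.
  by rewrite sw2_1 ?mul1r //; lin.
by rewrite (@sw2_counitl _ _ _ (fun t => sw2 t _)); last by lin.
Qed.
End HopfTheory.

(** * Coquasitriangular structures *)

Notation "'\Δ_' ( x , y <- c ) E" := (sw2 c (fun x y => E))
  (at level 41, x name, y name, c at level 99, E at level 41, right associativity,
   format "'[' '\Δ_' ( x ,  y  <-  c ) '/  '  E ']'") : ring_scope.
Notation "'\Δ_' ( x , y , z <- c ) E" := (sw2 c (fun x t => sw2 t (fun y z => E)))
  (at level 41, x name, y name, z name, c at level 99, E at level 41, right associativity,
   only parsing) : ring_scope.
Notation "'\Δ_' ( x , y , z , u <- c ) E" :=
  (sw2 c (fun x t => sw2 t (fun y t => sw2 t (fun z u => E))))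
  (at level 41, x name, y name, z name, u name, c at level 99, E at level 41, right associativity,
   only parsing) : ring_scope.
Notation "'\Δ_' ( x , y , z , u , v <- c ) E" :=
  (sw2 c (fun x t => sw2 t (fun y t => sw2 t (fun z t => sw2 t (fun u v => E)))))
  (at level 41, x name, y name, z name, u name, v name, c at level 99, E at level 41,
   right associativity, only parsing) : ring_scope.

Notation "'\Δ_' ( x , y , z , u , v , w <- c ) E" :=
  (sw2 c (fun x t => sw2 t (fun y t => sw2 t (fun z t => sw2 t (fun u t => sw2 t (fun v w => E))))))
  (at level 41, x name, y name, z name, u name, v name, w name, c at level 99, E at level 41,
   right associativity, only parsing) : ring_scope.
Notation "'\Δ_' ( x , y , z , u , v , w , a <- c ) E" :=
  (sw2 c (fun x t => sw2 t (fun y t => sw2 t (fun z t => sw2 t (fun u t => sw2 t (fun v t =>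
   sw2 t (fun w a => E)))))))
  (at level 41, x name, y name, z name, u name, v name, w name, a name, c at level 99, E at level 41,
   right associativity, only parsing) : ring_scope.

Section Pull.
Variables (k : fieldType) (H : hopfAlgType k).
Implicit Types U V W : lmodType k.

Lemma sw2_kmull c (F : H -> H -> k^o) (x : k) :
  (sw2 c F : k) * x = sw2 c (fun a b => (F a b : k) * x : k^o).
Proof. by apply: (@sw2_comp _ _ _ k^o (fun z : k^o => (z : k) * x)); lin. Qed.
Lemma sw2_kmulr c (F : H -> H -> k^o) (x : k) :
  x * (sw2 c F : k) = sw2 c (fun a b => x * (F a b : k) : k^o).
Proof. by apply: (@sw2_comp _ _ _ k^o (fun z : k^o => x * (z : k))); lin. Qed.
Lemma sw2_scalel U c (F : H -> H -> k^o) (x : U) :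
  (sw2 c F : k) *: x = sw2 c (fun a b => (F a b : k) *: x).
Proof. by apply: (@sw2_comp _ _ _ U (fun z : k^o => (z : k) *: x)); lin. Qed.
Lemma sw2_scaler U c (F : H -> H -> U) (x : k) :
  x *: sw2 c F = sw2 c (fun a b => x *: F a b).
Proof. by apply: (@sw2_comp _ _ _ U (fun z => x *: z)); lin. Qed.
Lemma sw2_mull c (F : H -> H -> H) (x : H) :
  sw2 c F * x = sw2 c (fun a b => F a b * x).
Proof. by apply: (@sw2_comp _ _ H H (fun z => z * x)); lin. Qed.
Lemma sw2_mulr c (F : H -> H -> H) (x : H) :
  x * sw2 c F = sw2 c (fun a b => x * F a b).
Proof. by apply: (@sw2_comp _ _ H H (fun z => x * z)); lin. Qed.
Lemma sw2_tensl V W c (F : H -> H -> V) (x : W) :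
  sw2 c F ⊗ x = sw2 c (fun a b => F a b ⊗ x).
Proof. by apply: (@sw2_comp _ _ V _ (fun z => z ⊗ x)); lin. Qed.
Lemma sw2_tensr V W c (F : H -> H -> V) (x : W) :
  x ⊗ sw2 c F = sw2 c (fun a b => x ⊗ F a b).
Proof. by apply: (@sw2_comp _ _ V _ (fun z => x ⊗ z)); lin. Qed.

Lemma sw3E U (F : H -> H -> H -> U) h :
  (forall z, bilinear_map (fun x y => F x y z)) -> (forall x y, islin (F x y)) ->
  \sw3_(x ⊗ y ⊗ z <- comul2 h) F x y z = \Δ_(x, y, z <- h) F x y z.
Proof.
move=> bF lF; pose G := fun (xy : (H ⊗ H)%type) (z : H) => tlift (fun x y => F x y z) xy.
have bG : bilinear_map G.
  apply: bilinI => [z|xy]; first exact: tlift_linear.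
  by rewrite /G; apply: lin_tlift => x y; apply: lF.
have lG : islin (tlift G) by apply: tlift_linear.
have e : comul2 h = \Δ_(x, y <- h) (cop x ⊗ y) by [].
transitivity (tlift G (\Δ_(x, y <- h) (cop x ⊗ y))); first by [].
rewrite (sw2_comp _ _ lG); transitivity (\Δ_(p, z <- h) \Δ_(x, y <- p) F x y z).
  by apply: eq_sw2 => p z; apply: tlift_tens.
by apply: sw2A => *; [apply: (proj1 (bF _)) | apply: (proj2 (bF _)) | apply: lF].
Qed.

End Pull.

(** [sws] normalizes a summand, [peel] goes under a Sweedler sum, [pull] moves
    sums out of products, scalings and tensors, [expand] closes an equation
    whose sides become the same iterated sum once all sums are pulled out, and
    [by_id e] rewrites with [e] up to [sws]. *)
Ltac scale_eq := lazymatch goal with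
  |- @eq _ (@GRing.scale ?R ?V ?c ?v) (@GRing.scale _ _ ?d ?v) =>
  refine (congr1 (fun z => @GRing.scale R V z v) (_ : c = d)); ring end.
Ltac sws :=
  rewrite ?(SM, scalerA, tensZl, tensZr, =^~ scalerAl, =^~ scalerAr);
  rewrite ?(scalerA, tensZl, tensZr, =^~ scalerAl, =^~ scalerAr);
  rewrite ?mulrA ?mul1r ?mulr1; try scale_eq.
Ltac peel := refine (eq_sw2 _ _) => ? ?.
Ltac pull := rewrite ?(sw2_scaler, sw2_scalel, sw2_kmull, sw2_kmulr, sw2_mull,
  sw2_mulr, sw2_tensl, sw2_tensr).
Ltac by_id e := refine (etrans (etrans _ e) _); repeat peel; sws.
Ltac expand := repeat (pull; peel); sws.

(** The axioms for the bilinear form r(x, y) = R(x ⊗ y), so that computations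
    need not mention pure tensors. *)
Record coquasi (k : fieldType) (H : hopfAlgType k) (r : H -> H -> k^o) : Prop := Coquasi {
  coquasi_bilinear : bilinear_map r;
  r_inv : exists2 ri : H -> H -> k^o, bilinear_map ri &
    forall h g, \Δ_(h1, h2 <- h) \Δ_(g1, g2 <- g) ((r h1 g1 : k) * ri h2 g2 : k^o) =
      (eps h : k) * eps g;
  r_mulr : forall h g f, r h (g * f) = \Δ_(h1, h2 <- h) ((r h1 f : k) * r h2 g : k^o);
  r_mull : forall h g f, r (h * g) f = \Δ_(f1, f2 <- f) ((r h f1 : k) * r g f2 : k^o);
  r_comm : forall h g,
    \Δ_(h1, h2 <- h) \Δ_(g1, g2 <- g) (r h2 g2 : k) *: (g1 * h1) =
    \Δ_(h1, h2 <- h) \Δ_(g1, g2 <- g) (r h1 g1 : k) *: (h2 * g2)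
}.

Lemma coquasi_of (k : fieldType) (H : hopfAlgType k) (R : {linear (H ⊗ H)%type -> k^o}) :
  coquasitriangular R -> coquasi (fun x y : H => R (x ⊗ y)).
Proof.
move=> hR.
have bil (Q : {linear (H ⊗ H)%type -> k^o}) : bilinear_map (fun x y : H => Q (x ⊗ y)).
  have lQ : islin Q by move=> a x y; apply: linearP.
  by apply: bilinI => y; apply: (lin_comp lQ); lin.
split.
- exact: bil.
- have [Ri [inv _]] := cqt_invertible hR; exists (fun x y => Ri (x ⊗ y)); first exact: bil.
  exact: inv.
- exact: (cqt_mulr hR).
- exact: (cqt_mull hR).
- exact: (cqt_comm hR).
Qed.

(* From here on the structure maps are known through their laws only. *)
#[global] Opaque S eps cop.

Section Coquasi.
Variables (k : fieldType) (H : hopfAlgType k) (r : H -> H -> k^o).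
Hypothesis hr : coquasi r.
Implicit Types U V W : lmodType k.
Let br := coquasi_bilinear hr.
Let r_mulr := r_mulr hr.
Let r_mull := r_mull hr.

Lemma rcross U (L : H -> U) h g : islin L ->
  \Δ_(h1, h2 <- h) \Δ_(g1, g2 <- g) (r h2 g2 : k) *: L (g1 * h1) =
  \Δ_(h1, h2 <- h) \Δ_(g1, g2 <- g) (r h1 g1 : k) *: L (h2 * g2).
Proof.
move=> lL; have /(congr1 L) e := r_comm hr h g.
rewrite !(sw2_comp _ _ lL) in e; apply: (etrans _ (etrans e _)).
  peel; rewrite (sw2_comp _ _ lL); peel; rewrite (islinZ _ _ lL) //.
peel; rewrite (sw2_comp _ _ lL); peel; rewrite (islinZ _ _ lL) //.
Qed.

(** An idempotent with a right inverse, in the convolution algebra, is the unit.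
    This gives r(1, f) = ε(f), because r(1, f) = r(1, f_1) r(1, f_2). *)
Lemma conv_idem (f g : H -> k^o) : islin f -> islin g ->
  (forall x, f x = \Δ_(a, b <- x) ((f a : k) * f b : k^o)) ->
  (forall x, \Δ_(a, b <- x) ((f a : k) * g b : k^o) = eps x) ->
  forall x, f x = eps x.
Proof.
move=> lf lg ff fg x; rewrite -fg.
transitivity (\Δ_(a, y <- x) \Δ_(b, c <- y) ((f a : k) * ((f b : k) * g c) : k^o)).
  rewrite -[LHS](@sw2_counitr _ _ k^o f) //; peel.
  by rewrite -fg -sw2_kmulr mulrC.
sw [:: x] [:: 0; 0]%N; peel; rewrite [in RHS]ff sw2_kmull; peel.
by rewrite mulrA.
Qed.

Lemma r1l f : r 1 f = eps f.
Proof.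
have [ri bri inv] := r_inv hr.
apply: (@conv_idem (r 1) (ri 1)); [lin | lin | | ]; move=> {}f.
  by rewrite -r_mull mulr1.
have : \Δ_(h1, h2 <- 1) \Δ_(f1, f2 <- f) ((r h1 f1 : k) * ri h2 f2 : k^o) =
       (eps (1 : H) : k) * eps f by apply: inv.
by rewrite eps1 mul1r sw2_1 //; lin.
Qed.

Lemma r1r f : r f 1 = eps f.
Proof.
have [ri bri inv] := r_inv hr.
apply: (@conv_idem (fun f => r f 1) (fun f => ri f 1)); [lin | lin | | ]; move=> {}f.
  by rewrite -r_mulr mulr1.
have : \Δ_(f1, f2 <- f) \Δ_(h1, h2 <- 1) ((r f1 h1 : k) * ri f2 h2 : k^o) =
       (eps f : k) * eps (1 : H) by apply: inv.
rewrite eps1 mulr1 => <-; peel; rewrite sw2_1 //; lin.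
Qed.

(** The first of four cancellations between r and its versions with one antipode.
    Since r is antimultiplicative in its second argument, the legs of that
    argument are in the opposite order when the antipode sits there. *)
Lemma rSr_inv h g :
  \Δ_(h1, h2 <- h) \Δ_(g1, g2 <- g) ((r h1 (S g2) : k) * r h2 g1 : k^o) =
  (eps h : k) * eps g.
Proof.
rewrite sw2_swap; transitivity (\Δ_(g1, g2 <- g) r h (g1 * S g2)).
  by peel; rewrite r_mulr.
by apply: (etrans (@Sr _ _ k^o (r h) g _)); [lin | rewrite r1r; apply: mulrC].
Qed.

Lemma rSr_invl h g :
  \Δ_(h1, h2 <- h) \Δ_(g1, g2 <- g) ((r h1 g2 : k) * r h2 (S g1) : k^o) =
  (eps h : k) * eps g.
Proof.
rewrite sw2_swap; transitivity (\Δ_(g1, g2 <- g) r h (S g1 * g2)).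
  by peel; rewrite r_mulr.
by apply: (etrans (@Sl _ _ k^o (r h) g _)); [lin | rewrite r1r; apply: mulrC].
Qed.

Lemma rSl_inv h g :
  \Δ_(h1, h2 <- h) \Δ_(g1, g2 <- g) ((r h1 g1 : k) * r (S h2) g2 : k^o) =
  (eps h : k) * eps g.
Proof.
transitivity (\Δ_(h1, h2 <- h) r (h1 * S h2) g).
  by peel; rewrite r_mull.
by apply: (etrans (@Sr _ _ k^o (fun h => r h g) h _)); [lin | rewrite r1l].
Qed.

Lemma rSl_invl h g :
  \Δ_(h1, h2 <- h) \Δ_(g1, g2 <- g) ((r (S h1) g1 : k) * r h2 g2 : k^o) =
  (eps h : k) * eps g.
Proof.
transitivity (\Δ_(h1, h2 <- h) r (S h1 * h2) g).
  by peel; rewrite r_mull.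
by apply: (etrans (@Sl _ _ k^o (fun h => r h g) h _)); [lin | rewrite r1l].
Qed.

Lemma sw2_counit_lr U (F : H -> H -> U) h g : bilinear_map F ->
  \Δ_(x, h' <- h) \Δ_(g', y <- g) ((eps x : k) * eps y) *: F h' g' = F h g.
Proof.
move=> bF; transitivity (\Δ_(x, h' <- h) (eps x : k) *: F h' g).
  apply: eq_sw2 => x h'.
  transitivity (\Δ_(g', y <- g) (eps x : k) *: ((eps y : k) *: F h' g')).
    by peel; rewrite scalerA.
  by rewrite -sw2_scaler; congr (_ *: _); apply: (@sw2_counitr _ _ _ (F h')); lin.
by apply: (@sw2_counitl _ _ _ (fun h => F h g)); lin.
Qed.

Lemma sw2_counit_rl U (F : H -> H -> U) h g : bilinear_map F ->
  \Δ_(h', x <- h) \Δ_(y, g' <- g) ((eps x : k) * eps y) *: F h' g' = F h g.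
Proof.
move=> bF; transitivity (\Δ_(h', x <- h) (eps x : k) *: F h' g).
  apply: eq_sw2 => h' x.
  transitivity (\Δ_(y, g' <- g) (eps x : k) *: ((eps y : k) *: F h' g')).
    by peel; rewrite scalerA.
  by rewrite -sw2_scaler; congr (_ *: _); apply: (@sw2_counitl _ _ _ (F h')); lin.
by apply: (@sw2_counitr _ _ _ (fun h => F h g)); lin.
Qed.

Lemma sw2_counit_ll U (F : H -> H -> U) h g : bilinear_map F ->
  \Δ_(x, h' <- h) \Δ_(y, g' <- g) ((eps x : k) * eps y) *: F h' g' = F h g.
Proof.
move=> bF; transitivity (\Δ_(x, h' <- h) (eps x : k) *: F h' g).
  apply: eq_sw2 => x h'.
  transitivity (\Δ_(y, g' <- g) (eps x : k) *: ((eps y : k) *: F h' g')).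
    by peel; rewrite scalerA.
  by rewrite -sw2_scaler; congr (_ *: _); apply: (@sw2_counitl _ _ _ (F h')); lin.
by apply: (@sw2_counitl _ _ _ (fun h => F h g)); lin.
Qed.

(** Invariance under S ⊗ S: both r(S -, S -) and r are inverse to r(-, S -), on
    different sides, so that the triple product of these forms is equal to both. *)
Lemma rSS h g : r (S h) (S g) = r h g.
Proof.
transitivity (\Δ_(h1, h2, h3 <- h) \Δ_(g1, g2, g3 <- g)
   ((r h1 g3 : k) * r h2 (S g2) * r (S h3) (S g1) : k^o)).
  swr [:: h; g] [:: 0; 2; 0; 4]%N.
  refine (@etrans k^o _ _ _
    (esym (@sw2_counit_lr k^o (fun x y => r (S x) (S y)) h g _)) _); first by lin.
  apply: eq_sw2 => x h3; apply: eq_sw2 => g1 y.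
  rewrite -rSr_invl /GRing.scale /= sw2_kmull; peel; rewrite sw2_kmull; peel.
  by [].
sw [:: h; g] [:: 0; 2; 1; 3]%N.
refine (etrans _ (@sw2_counit_rl k^o r h g _)); last by lin.
apply: eq_sw2 => h1 x; apply: eq_sw2 => y g3.
transitivity ((\Δ_(h2, h3 <- x) \Δ_(f1, f2 <- S y)
  ((r h2 f1 : k) * r (S h3) f2 : k^o) : k) * r h1 g3 : k^o); last first.
  by rewrite rSl_inv epsS.
rewrite sw2_kmull; apply: eq_sw2 => h2 h3.
rewrite sw2_S ?sw2_kmull; last by lin.
by apply: eq_sw2 => g1 g2; ring.
Qed.

(** [rcross] conjugated by the antipode: insert S(b_1) b_2 in front, cross, and
    cancel b_3 S(b_4) at the end. *)
Lemma rcross_Sl U (L : H -> U) b g : islin L ->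
  \Δ_(b1, b2 <- b) \Δ_(g1, g2 <- g) (r g2 b1 : k) *: L (g1 * S b2) =
  \Δ_(b1, b2 <- b) \Δ_(g1, g2 <- g) (r g1 b2 : k) *: L (S b1 * g2).
Proof.
move=> lL.
transitivity (\Δ_(b1, b2, b3, b4 <- b) \Δ_(g1, g2 <- g)
  (r g2 b3 : k) *: L (S b1 * b2 * g1 * S b4)).
  swr [:: b; g] [:: 0; 0; 0; 4]%N; apply: eq_sw2 => y b4.
  rewrite (@Sl_l _ _ _ (fun u b => \Δ_(g1, g2 <- g)
    (r g2 b : k) *: L (u * g1 * S b4))); last by lin.
  by peel; rewrite mul1r.
transitivity (\Δ_(b1, b2, b3, b4 <- b) \Δ_(g1, g2 <- g)
  (r g1 b2 : k) *: L (S b1 * g2 * (b3 * S b4))).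
  sw [:: b; g] [:: 0; 1; 3; 1]%N; swr [:: b; g] [:: 0; 1; 3; 1]%N.
  apply: eq_sw2 => b1 t; apply: eq_sw2 => p b4.
  refine (etrans _ (etrans (@rcross _ (fun z => L (S b1 * z * S b4)) g p _) _));
    [| lin |]; by peel; peel; rewrite !mulrA.
apply: eq_sw2 => b1 y.
rewrite (@Sr_r _ _ _ (fun b2 u => \Δ_(g1, g2 <- g) (r g1 b2 : k) *: L (S b1 * g2 * u)));
  last by lin.
by peel; rewrite mulr1.
Qed.

(** [rcross] for g = S(b), whose legs are S(b_2) and S(b_1). *)
Lemma rcross_Sr U (L : H -> U) a b : islin L ->
  \Δ_(a1, a2 <- a) \Δ_(b1, b2 <- b) (r a2 (S b1) : k) *: L (S b2 * a1) =
  \Δ_(a1, a2 <- a) \Δ_(b1, b2 <- b) (r a1 (S b2) : k) *: L (a2 * S b1).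
Proof.
move=> lL; have := @rcross _ L a (S b) lL.
refine (fun e => etrans (etrans _ e) _); peel; rewrite sw2_S //; lin.
Qed.

(** * The transmuted algebra *)

Definition tact (h g : H) : H := \Δ_(h1, h2, h3 <- h) \Δ_(g1, g2 <- g)
  ((r g1 h1 : k) * r h3 g2) *: h2.
Definition tmul (h g : H) : H := \Δ_(h1, h2, h3 <- h) \Δ_(g1, g2, g3 <- g)
  ((r h3 (S g1) : k) * r h1 g2) *: (h2 * g3).
Definition ad (h : H) : H ⊗ H := \Δ_(h1, h2, h3 <- h) (h2 ⊗ (S h1 * h3)).

Lemma tact_bilinear : bilinear_map tact.
Proof. by apply: bilinI => y; rewrite /tact; lin. Qed.
Lemma tmul_bilinear : bilinear_map tmul.
Proof. by apply: bilinI => y; rewrite /tmul; lin. Qed.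
Lemma ad_linear : islin ad.
Proof. by rewrite /ad; lin. Qed.

Lemma linear_tact U (L : H -> U) h g : islin L -> L (tact h g) =
  \Δ_(h1, h2, h3 <- h) \Δ_(g1, g2 <- g) ((r g1 h1 : k) * r h3 g2) *: L h2.
Proof.
by move=> lL; rewrite /tact !(sw2_comp _ _ lL); do 3!(peel; rewrite ?(sw2_comp _ _ lL));
  rewrite (islinZ _ _ lL).
Qed.
Lemma linear_tmul U (L : H -> U) h g : islin L -> L (tmul h g) =
  \Δ_(h1, h2, h3 <- h) \Δ_(g1, g2, g3 <- g) ((r h3 (S g1) : k) * r h1 g2) *: L (h2 * g3).
Proof.
by move=> lL; rewrite /tmul !(sw2_comp _ _ lL); do 4!(peel; rewrite ?(sw2_comp _ _ lL));
  rewrite (islinZ _ _ lL).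
Qed.
Lemma tlift_ad U (F : H -> H -> U) h : bilinear_map F ->
  tlift F (ad h) = \Δ_(h1, h2, h3 <- h) F h2 (S h1 * h3).
Proof.
move=> bF; have lF : islin (tlift F) by apply: tlift_linear.
by rewrite /ad (sw2_comp _ _ lF); peel; rewrite (sw2_comp _ _ lF); peel; apply: tlift_tens.
Qed.

Lemma sw3_counit U (F : H -> U) c : islin F ->
  \Δ_(x, c', y <- c) ((eps x : k) * eps y) *: F c' = F c.
Proof.
move=> lF; rewrite -[RHS](sw2_counitl _ lF); apply: eq_sw2 => x t.
transitivity (\Δ_(c', y <- t) (eps x : k) *: ((eps y : k) *: F c')).
  by peel; rewrite scalerA.
by rewrite -sw2_scaler sw2_counitr.
Qed.

Lemma tact1 b : tact b 1 = b.
Proof.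
rewrite -[RHS](@sw3_counit _ (fun x => x) b); last by lin.
by do 2!peel; rewrite sw2_1 ?r1l ?r1r //; lin.
Qed.

(** Both sides are the sum of r(h_1, b_1) r(g_1, b_2) r(b_4, g_2) r(b_5, h_2) b_3. *)
Lemma tactM b h g : tact b (h * g) = tact (tact b h) g.
Proof.
transitivity (\Δ_(b1, b2, b3, b4, b5 <- b) \Δ_(h1, h2 <- h) \Δ_(g1, g2 <- g)
  ((r h1 b1 : k) * r g1 b2 * r b4 g2 * r b5 h2) *: b3).
  transitivity (\Δ_(b1, b2, b3 <- b) \Δ_(h1, h2 <- h) \Δ_(g1, g2 <- g)
     \Δ_(x, y <- b1) \Δ_(u, v <- b3) ((r h1 x : k) * r g1 y * (r u g2 * r v h2)) *: b2).
    do 2!peel; rewrite sw2_mul; last by lin.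
    by do 2!peel; rewrite r_mull r_mulr; expand.
  sw [:: b; h; g] [:: 0; 1; 2; 3; 5; 7]%N; expand.
rewrite (@linear_tact _ (fun z => tact z g)); last by move: tact_bilinear => btact; lin.
transitivity (\Δ_(b1, b2, b3 <- b) \Δ_(h1, h2 <- h) \Δ_(x, y, z <- b2) \Δ_(g1, g2 <- g)
  (((r h1 b1 : k) * r b3 h2) * ((r g1 x : k) * r z g2)) *: y).
  swr [:: b; h; g] [:: 0; 1; 1; 2; 5; 7]%N.
  sw [:: b; h; g] [:: 0; 1; 1; 2; 5; 7]%N.
  by expand.
by expand.
Qed.

Lemma ad_counit b : tlift (fun b0 b1 => (eps b1 : k) *: b0) (ad b) = b.
Proof.
rewrite tlift_ad; last by lin.
rewrite -[RHS](@sw3_counit _ (fun x => x) b); last by lin.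
by do 2!peel; rewrite epsM epsS.
Qed.

Lemma adA b : tlift (fun b0 b1 => ad b0 ⊗ b1) (ad b) =
  tlift (fun b0 b1 => \Δ_(h1, h2 <- b1) ((b0 ⊗ h1) ⊗ h2)) (ad b).
Proof.
have lad := ad_linear; rewrite !tlift_ad; try lin.
transitivity (\Δ_(b1, b2, b3, b4, b5 <- b) ((b3 ⊗ (S b2 * b4)) ⊗ (S b1 * b5))).
  transitivity (\Δ_(b1, b2, b3 <- b) \Δ_(x, y, z <- b2) ((y ⊗ (S x * z)) ⊗ (S b1 * b3))).
    by expand.
  by sw [:: b] [:: 0; 1; 2; 3]%N.
symmetry.
transitivity (\Δ_(b1, b2, b3 <- b) \Δ_(x, y <- b1) \Δ_(u, v <- b3)
  ((b2 ⊗ (S y * u)) ⊗ (S x * v))).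
  do 2!peel; rewrite sw2_mul; last by lin.
  by rewrite sw2_S; last by lin.
by sw [:: b] [:: 0; 1; 2; 3]%N.
Qed.

(** With both sides written over b_1, ..., b_5 and h_1, h_2, h_3, where b_3 is the
    surviving leg, [rcross_Sl] carries r(h, b) across h_1 S(b_2), and [rcross]
    carries r(b, h) across h_2 b_4. *)
Lemma tact_ad_compat b h :
  \Δ_(h1, h2 <- h) tlift (fun c0 c1 => c0 ⊗ (h1 * c1)) (ad (tact b h2)) =
  tlift (fun b0 b1 => \Δ_(h1, h2 <- h) (tact b0 h1 ⊗ (b1 * h2))) (ad b).
Proof.
have lad := ad_linear; have btact := tact_bilinear.
transitivity (\Δ_(b1, b2, b3, b4, b5 <- b) \Δ_(h1, h2, h3 <- h)
  ((r h2 b1 : k) * r b5 h3) *: (b3 ⊗ (h1 * S b2 * b4))).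
  transitivity (\Δ_(h1, t <- h) \Δ_(b1, b2, b3 <- b) \Δ_(h2, h3 <- t) \Δ_(x, y, z <- b2)
    ((r h2 b1 : k) * r b3 h3) *: (y ⊗ (h1 * S x * z))).
    apply: eq_sw2 => h1 t.
    rewrite (@linear_tact _ (fun z => tlift (fun c0 c1 => c0 ⊗ (h1 * c1)) (ad z))); last by lin.
    do 3!peel; rewrite tlift_ad; last by lin.
    by expand.
  by sw [:: b; h] [:: 0; 1; 2; 3; 5; 6]%N.
transitivity (\Δ_(b1, b2, b3, b4, b5 <- b) \Δ_(h1, h2, h3 <- h)
  ((r h1 b2 : k) * r b5 h3) *: (b3 ⊗ (S b1 * (h2 * b4)))).
  sw [:: b; h] [:: 0; 1; 2; 4; 0; 5]%N; swr [:: b; h] [:: 0; 1; 2; 4; 0; 5]%N.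
  apply: eq_sw2 => p t; apply: eq_sw2 => b3 t'.
  apply: eq_sw2 => b4 b5; apply: eq_sw2 => q h3.
  by by_id (@rcross_Sl _ (fun z => (r b5 h3 : k) *: (b3 ⊗ (z * b4))) p q ltac:(lin)).
transitivity (\Δ_(b1, b2, b3, b4, b5 <- b) \Δ_(h1, h2, h3 <- h)
  ((r h1 b2 : k) * r b4 h2) *: (b3 ⊗ (S b1 * (b5 * h3)))).
  sw [:: b; h] [:: 0; 1; 2; 4; 3; 6]%N; swr [:: b; h] [:: 0; 1; 2; 4; 3; 6]%N.
  apply: eq_sw2 => b1 t; apply: eq_sw2 => b2 t'.
  apply: eq_sw2 => b3 p; apply: eq_sw2 => h1 q.
  by by_id (@rcross _ (fun z => (r h1 b2 : k) *: (b3 ⊗ (S b1 * z))) p q ltac:(lin)).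
rewrite tlift_ad; last by lin.
transitivity (\Δ_(b1, b2, b3 <- b) \Δ_(h1, h2 <- h) \Δ_(x, y, z <- b2) \Δ_(u, v <- h1)
  ((r u x : k) * r z v) *: (y ⊗ (S b1 * (b3 * h2)))); last first.
  by do 3!peel; rewrite /tact; expand.
by sw [:: b; h] [:: 0; 1; 1; 2; 5; 5]%N; swr [:: b; h] [:: 0; 1; 1; 2; 5; 5]%N.
Qed.

Lemma tmul1r h : tmul h 1 = h.
Proof.
rewrite -[RHS](@sw3_counit _ (fun x => x) h); last by lin.
do 2!peel; rewrite sw2_1; last by lin.
by rewrite sw2_1 ?S1 ?r1r ?mulr1 1?mulrC //; lin.
Qed.

Lemma tmul1l h : tmul 1 h = h.
Proof.
rewrite /tmul sw2_1; last by lin.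
rewrite sw2_1; last by lin.
rewrite -[RHS](@sw2_counitl _ _ _ (fun x => x) h); last by lin.
apply: eq_sw2 => h1 t; rewrite -{2}[t]eps_l sw2_scaler.
by peel; rewrite !r1l epsS mul1r scalerA.
Qed.

Lemma tact_one h : tact 1 h = (eps h : k) *: 1.
Proof.
rewrite /tact sw2_1; last by lin.
rewrite sw2_1; last by lin.
rewrite -{2}[h](eps_l h) (sw2_comp _ _ (@lin_eps k H)) sw2_scalel.
by peel; rewrite r1l r1r (islinZ _ _ (@lin_eps k H)).
Qed.

Lemma ad_one : ad 1 = 1 ⊗ 1.
Proof.
rewrite /ad sw2_1; last by lin.
by rewrite sw2_1 ?S1 ?mulr1 //; lin.
Qed.

(** The product is that of H twisted by the adjoint coaction of its first factor:
    a • b = a_(0) b_2 r(a_(1), S b_1).  Indeed r(a_1, b_2) = r(S a_1, S b_2) by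
    [rSS], which combines with r(a_3, S b_1) by multiplicativity of r. *)
Lemma tmulE a b :
  tmul a b = \Δ_(a1, a2, a3 <- a) \Δ_(b1, b2 <- b) (r (S a1 * a3) (S b1) : k) *: (a2 * b2).
Proof.
transitivity (\Δ_(a1, a2, a3 <- a) \Δ_(b1, b2 <- b) \Δ_(x, y <- b1)
  ((r a1 y : k) * r a3 (S x)) *: (a2 * b2)); last first.
  do 3!peel; rewrite r_mull sw2_S; last by lin.
  by rewrite sw2_scalel; peel; rewrite rSS.
rewrite /tmul; sw [:: a; b] [:: 0; 1; 3; 3]%N; swr [:: a; b] [:: 0; 1; 3; 3]%N.
by do ?peel; sws.
Qed.

Lemma linear_tmulE U (L : H -> U) a b : islin L ->
  L (tmul a b) = \Δ_(a1, a2, a3 <- a) \Δ_(b1, b2 <- b)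
    (r (S a1 * a3) (S b1) : k) *: L (a2 * b2).
Proof.
by move=> lL; rewrite tmulE !(sw2_comp _ _ lL); do 3!(peel; rewrite ?(sw2_comp _ _ lL));
  rewrite (islinZ _ _ lL).
Qed.

Lemma sw3_mul U (F : H -> H -> H -> U) x y :
  (forall a b, islin (fun c => F a b c)) -> (forall a c, islin (fun b => F a b c)) ->
  (forall b c, islin (fun a => F a b c)) ->
  \Δ_(a, b, c <- x * y) F a b c =
  \Δ_(x1, x2, x3 <- x) \Δ_(y1, y2, y3 <- y) F (x1 * y1) (x2 * y2) (x3 * y3).
Proof.
move=> l1 l2 l3; have lin3 (f : H -> H) b c : islin f -> islin (fun a => F (f a) b c).
  by move=> lf; apply: (lin_comp (l3 b c)).
have lin2 (f : H -> H) a c : islin f -> islin (fun b => F a (f b) c).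
  by move=> lf; apply: (lin_comp (l2 a c)).
have lin1 (f : H -> H) a b : islin f -> islin (fun c => F a b (f c)).
  by move=> lf; apply: (lin_comp (l1 a b)).
transitivity (\Δ_(x1, t <- x) \Δ_(y1, s <- y) \Δ_(x2, x3 <- t) \Δ_(y2, y3 <- s)
  F (x1 * y1) (x2 * y2) (x3 * y3)).
  rewrite sw2_mul; last by lin.
  by do 2!peel; rewrite sw2_mul //; lin.
by sw [:: x; y] [:: 0; 1; 3; 4]%N.
Qed.

(** Both sides are written over a_1, ..., a_5 and b_1, ..., b_5, with a_3 b_4 in the
    first tensor factor.  Under the antipode r(a_1, b_2) crosses a_2 b_3, and then
    r(a_5, S b_1) crosses S(b_2) a_4. *)
Lemma ad_tmul a b : ad (tmul a b) =
  tlift (fun a0 a1 => tlift (fun b0 b1 => tmul a0 b0 ⊗ (a1 * b1)) (ad b)) (ad a).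
Proof.
have lad := ad_linear; have btmul := tmul_bilinear.
transitivity (\Δ_(a1, a2, a3, a4, a5 <- a) \Δ_(b1, b2, b3, b4, b5 <- b)
  ((r a5 (S b1) : k) * r a1 b2) *: ((a3 * b4) ⊗ (S (a2 * b3) * (a4 * b5)))).
  rewrite (linear_tmul _ _ lad).
  transitivity (\Δ_(a1, a2, a3 <- a) \Δ_(b1, b2, b3 <- b) \Δ_(x, y, z <- a2)
     \Δ_(u, v, w <- b3) ((r a3 (S b1) : k) * r a1 b2) *:
       ((y * v) ⊗ (S (x * u) * (z * w)))).
    do 4!peel; rewrite /ad sw3_mul; try by move=> *; lin.
    by expand.
  by sw [:: a; b] [:: 0; 1; 2; 3; 5; 6; 7; 8]%N.
transitivity (\Δ_(a1, a2, a3, a4, a5 <- a) \Δ_(b1, b2, b3, b4, b5 <- b)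
  ((r a5 (S b1) : k) * r a2 b3) *: ((a3 * b4) ⊗ (S a1 * (S b2 * a4) * b5))).
  sw [:: a; b] [:: 0; 1; 2; 4; 5; 6; 0; 6]%N; swr [:: a; b] [:: 0; 1; 2; 4; 5; 6; 0; 6]%N.
  apply: eq_sw2 => p t; apply: eq_sw2 => a3 t'; apply: eq_sw2 => a4 a5.
  apply: eq_sw2 => b1 s; apply: eq_sw2 => q s'; apply: eq_sw2 => b4 b5.
  symmetry.
  by by_id (@rcross _ (fun z => (r a5 (S b1) : k) *: ((a3 * b4) ⊗ (S z * (a4 * b5))))
    p q ltac:(lin)).
transitivity (\Δ_(a1, a2, a3, a4, a5 <- a) \Δ_(b1, b2, b3, b4, b5 <- b)
  ((r a4 (S b2) : k) * r a2 b3) *: ((a3 * b4) ⊗ (S a1 * (a5 * S b1) * b5))).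
  sw [:: a; b] [:: 0; 1; 2; 4; 5; 6; 3; 5]%N; swr [:: a; b] [:: 0; 1; 2; 4; 5; 6; 3; 5]%N.
  apply: eq_sw2 => a1 t; apply: eq_sw2 => a2 t'; apply: eq_sw2 => a3 p.
  apply: eq_sw2 => q s; apply: eq_sw2 => b3 s'; apply: eq_sw2 => b4 b5.
  by_id (@rcross_Sr _ (fun z => (r a2 b3 : k) *: ((a3 * b4) ⊗ (S a1 * z * b5))) p q ltac:(lin)).
rewrite tlift_ad; last by lin.
transitivity (\Δ_(a1, a2, a3 <- a) \Δ_(b1, b2, b3 <- b)
  tmul a2 b2 ⊗ ((S a1 * a3) * (S b1 * b3))).
  rewrite /tmul; transitivity (\Δ_(a1, a2, a3 <- a) \Δ_(b1, b2, b3 <- b)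
    \Δ_(x, y, z <- a2) \Δ_(u, v, w <- b2)
    ((r z (S u) : k) * r x v) *: ((y * w) ⊗ ((S a1 * a3) * (S b1 * b3)))); last by expand.
  sw [:: a; b] [:: 0; 1; 2; 3; 5; 6; 7; 8]%N; swr [:: a; b] [:: 0; 1; 2; 3; 5; 6; 7; 8]%N.
  by expand.
by do 2!peel; rewrite tlift_ad //; lin.
Qed.

(** By [tmulE] the outer product in (a • b) • c involves the coaction of a • b,
    which [ad_tmul] expresses by those of a and b. *)
Lemma tmulA a b c : tmul a (tmul b c) = tmul (tmul a b) c.
Proof.
have lad := ad_linear; have btmul := tmul_bilinear.
transitivity (\Δ_(a1, a2, a3, a4, a5 <- a) \Δ_(b1, b2, b3, b4 <- b) \Δ_(c1, c2, c3 <- c)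
  ((r (S a1 * a5) (S c2) : k) * r (S b1 * b4) (S c1) * r (S a2 * a4) (S b2)) *:
  (a3 * b3 * c3)).
  transitivity (\Δ_(b1, b2, b3 <- b) \Δ_(c1, c2 <- c) \Δ_(a1, a2, a3 <- a)
    \Δ_(b2', b2'' <- b2) \Δ_(c2', c2'' <- c2) \Δ_(x, y <- a1) \Δ_(u, v <- a3)
    ((r (S b1 * b3) (S c1) : k) * (r (S y * u) (S b2') * r (S x * v) (S c2'))) *:
    (a2 * (b2'' * c2''))).
    rewrite (@linear_tmulE _ (tmul a)); last by lin.
    do 3!peel; rewrite tmulE sw2_scaler; peel; rewrite sw2_scaler; peel.
    rewrite sw2_mul; last by lin.
    rewrite sw2_scaler; peel; rewrite sw2_scaler; peel.
    rewrite SM r_mulr sw2_mul; last by lin.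
    rewrite sw2_S; last by lin.
    by expand.
  by sw [:: a; b; c] [:: 0; 1; 2; 3; 5; 6; 7; 9; 10]%N; expand.
symmetry.
(* (a • b) • c = G((a • b)_(0), (a • b)_(1)) *)
pose G x0 x1 := \Δ_(c1, c2 <- c) (r x1 (S c1) : k) *: (x0 * c2).
have bG : bilinear_map G by rewrite /G; lin.
have lG : islin (tlift G) by apply: tlift_linear.
transitivity (\Δ_(a1, a2, a3 <- a) \Δ_(b1, b2, b3 <- b)
  G (tmul a2 b2) ((S a1 * a3) * (S b1 * b3))).
  rewrite tmulE -(@tlift_ad _ G) // ad_tmul (tlift_comp _ _ lG) tlift_ad; last by lin.
  do 2!peel; rewrite (tlift_comp _ _ lG) tlift_ad; last by lin.
  by do 2!peel; apply: tlift_tens.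
transitivity (\Δ_(a1, a2, a3 <- a) \Δ_(b1, b2, b3 <- b) \Δ_(c1, c2 <- c) \Δ_(f1, f2 <- c1)
  \Δ_(x, y, z <- a2) \Δ_(u, v <- b2)
  ((r (S a1 * a3) (S f2) : k) * r (S b1 * b3) (S f1) * r (S x * z) (S u)) *: (y * v * c2)).
  do 5!peel; rewrite tmulE r_mull sw2_S; last by lin.
  by expand.
by sw [:: a; b; c] [:: 0; 1; 2; 3; 5; 6; 7; 9; 10]%N.
Qed.

(** Both sides are written over legs of a and b, the surviving ones in the middle,
    with all else under r.  Then r(a_1, b_2) crosses a_2 b_3 inside r(h_1, -), and
    r(h_2, b_2) crosses S(b_1) h_3 inside r(a_4, -). *)
Lemma tact_tmul a b h : tact (tmul a b) h = \Δ_(h1, h2 <- h) tmul (tact a h1) (tact b h2).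
Proof.
have btact := tact_bilinear; have btmul := tmul_bilinear.
transitivity (\Δ_(a1, a2, a3, a4, a5 <- a) \Δ_(b1, b2, b3, b4, b5 <- b) \Δ_(h1, h2 <- h)
  ((r a5 (S b1) : k) * r a1 b2 * r h1 (a2 * b3) * r (a4 * b5) h2) *: (a3 * b4)).
  rewrite (@linear_tmul _ (fun z => tact z h)); last by lin.
  transitivity (\Δ_(a1, a2, a3 <- a) \Δ_(b1, b2, b3 <- b)
    \Δ_(x, y, z <- a2) \Δ_(u, v, w <- b3) \Δ_(h1, h2 <- h)
    ((r a3 (S b1) : k) * r a1 b2 * r h1 (x * u) * r (z * w) h2) *: (y * v)).
    do 4!peel; rewrite /tact sw3_mul; try by move=> *; lin.
    by expand.
  by sw [:: a; b; h] [:: 0; 1; 2; 3; 5; 6; 7; 8; 10]%N.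
transitivity (\Δ_(a1, a2, a3, a4, a5 <- a) \Δ_(b1, b2, b3, b4, b5 <- b) \Δ_(h1, h2 <- h)
  ((r a5 (S b1) : k) * r a2 b3 * r h1 (b2 * a1) * r (a4 * b5) h2) *: (a3 * b4)).
  sw [:: a; b; h] [:: 0; 1; 2; 4; 5; 6; 8; 0; 6]%N.
  swr [:: a; b; h] [:: 0; 1; 2; 4; 5; 6; 8; 0; 6]%N.
  apply: eq_sw2 => p t; apply: eq_sw2 => a3 t'; apply: eq_sw2 => a4 a5.
  apply: eq_sw2 => b1 s; apply: eq_sw2 => q s'; apply: eq_sw2 => b4 b5.
  apply: eq_sw2 => h1 h2; symmetry.
  by by_id (@rcross _ (fun z => ((r a5 (S b1) : k) * r h1 z * r (a4 * b5) h2) *: (a3 * b4))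
    p q ltac:(lin)).
transitivity (\Δ_(a1, a2, a3, a4 <- a) \Δ_(b1, b2, b3, b4, b5 <- b)
  \Δ_(h1, h2, h3, h4 <- h)
  ((r h2 b2 : k) * r a4 (S b1 * h3) * r a2 b3 * r h1 a1 * r b5 h4) *: (a3 * b4)).
  transitivity (\Δ_(a1, a2, a3, a4, a5 <- a) \Δ_(b1, b2, b3, b4, b5 <- b)
    \Δ_(h1, h2 <- h) \Δ_(u, v <- h2) \Δ_(x, y <- h1)
    ((r a5 (S b1) : k) * r a2 b3 * (r x a1 * r y b2) * (r a4 u * r b5 v)) *: (a3 * b4)).
    by do 9!peel; rewrite r_mull r_mulr; expand.
  transitivity (\Δ_(a1, a2, a3, t <- a) \Δ_(b1, b2, b3, b4, b5 <- b)
    \Δ_(h1, h2, h3, h4 <- h) \Δ_(a4, a5 <- t)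
    ((r h2 b2 : k) * (r a4 h3 * r a5 (S b1)) * r a2 b3 * r h1 a1 * r b5 h4) *: (a3 * b4)).
    sw [:: a; b; h] [:: 0; 1; 2; 4; 5; 6; 7; 9; 10; 11; 3]%N.
    by expand.
  by do 10!peel; rewrite r_mulr; expand.
transitivity (\Δ_(a1, a2, a3, a4 <- a) \Δ_(b1, b2, b3, b4, b5 <- b)
  \Δ_(h1, h2, h3, h4 <- h)
  ((r h3 b1 : k) * r a4 (h2 * S b2) * r a2 b3 * r h1 a1 * r b5 h4) *: (a3 * b4)).
  sw [:: a; b; h] [:: 0; 1; 2; 4; 5; 6; 8; 9; 4; 10]%N.
  swr [:: a; b; h] [:: 0; 1; 2; 4; 5; 6; 8; 9; 4; 10]%N.
  apply: eq_sw2 => a1 t; apply: eq_sw2 => a2 t'; apply: eq_sw2 => a3 a4.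
  apply: eq_sw2 => q s; apply: eq_sw2 => b3 s'; apply: eq_sw2 => b4 b5.
  apply: eq_sw2 => h1 u; apply: eq_sw2 => p h4; symmetry.
  by by_id (@rcross_Sl _ (fun z => ((r a4 z : k) * r a2 b3 * r h1 a1 * r b5 h4) *: (a3 * b4))
    q p ltac:(lin)).
transitivity (\Δ_(a1, a2, a3, t <- a) \Δ_(b1, b2, b3, b4, b5 <- b)
  \Δ_(h1, h2, h3, h4 <- h) \Δ_(a4, a5 <- t)
  ((r h3 b1 : k) * (r a4 (S b2) * r a5 h2) * r a2 b3 * r h1 a1 * r b5 h4) *: (a3 * b4)).
  by do 10!peel; rewrite r_mulr; expand.
symmetry.
transitivity (\Δ_(h1, t <- h) \Δ_(a1, a2, a3 <- a) \Δ_(x, y <- h1)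
  \Δ_(b1, b2, b3 <- b) \Δ_(u, v <- t) \Δ_(a1', a2', a3' <- a2) \Δ_(b1', b2', b3' <- b2)
  (((r x a1 : k) * r a3 y) * (r u b1 * r b3 v) * (r a3' (S b1') * r a1' b2')) *: (a2' * b3')).
  peel; rewrite (@linear_tact _ (fun z => tmul z _)); last by lin.
  do 3!peel; rewrite (@linear_tact _ (tmul _)); last by lin.
  by rewrite /tmul; expand.
sw [:: a; b; h] [:: 0; 1; 2; 4; 5; 6; 7; 9; 10; 11; 3]%N.
by expand.
Qed.
End Coquasi.

Section BraidedCommutativity.
Variables (k : fieldType) (H : hopfAlgType k) (r : H -> H -> k^o).
Hypothesis hr : coquasi r.
Implicit Types U V W : lmodType k.
Let br := coquasi_bilinear hr.
Let r_mulr := r_mulr hr.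
Let r_mull := r_mull hr.
Local Notation tmul := (tmul r).
Local Notation tact := (tact r).

(** Written out, b_(0) • (a ◁ b_(1)) has five factors r.  Two of them cancel by
    [rSr_inv] and two more by [rSl_invl]; this leaves r(a_2, S(b_1) b_3) b_2 a_1,
    which is one crossing away from a • b. *)
Lemma tmul_braided_comm a b : tmul a b = tlift (fun b0 b1 => tmul b0 (tact a b1)) (ad b).
Proof.
have btact := tact_bilinear hr; have btmul := tmul_bilinear hr.
rewrite tlift_ad; last by lin.
symmetry.
transitivity (\Δ_(a1, a2, a3, a4, a5, a6 <- a) \Δ_(b1, b2, b3, b4, b5, b6, b7 <- b)
  ((r b5 (S a3) : k) * r b6 a2 * (r (S b2) a1 * r b3 a4 * r a6 (S b1 * b7))) *: (b4 * a5)).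
  transitivity (\Δ_(b1, b2, b3 <- b) \Δ_(a1, a2, a3 <- a) \Δ_(x, y <- b1) \Δ_(z, w <- b3)
    \Δ_(b1', b2', b3' <- b2) \Δ_(a1', a2', a3' <- a2) \Δ_(u, v <- a1)
    ((r (S y) u : k) * r z v * r a3 (S x * w) * (r b3' (S a1') * r b1' a2')) *: (b2' * a3')).
    do 2!peel; rewrite (@linear_tact _ _ r _ (tmul _)); last by lin.
    do 2!peel; rewrite sw2_mul; last by lin.
    rewrite sw2_S; last by lin.
    by do 2!peel; rewrite r_mull /tmul; expand.
  sw [:: a; b] [:: 0; 1; 2; 3; 4; 6; 7; 8; 9; 10; 11]%N.
  by expand.
transitivity (\Δ_(a1, a2, a3, a4 <- a) \Δ_(b1, b2, b3, b4, b5 <- b)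
  ((r (S b2) a1 : k) * r b3 a2 * r a4 (S b1 * b5)) *: (b4 * a3)).
  sw [:: a; b] [:: 0; 1; 2; 4; 5; 6; 7; 7; 1; 9; 1]%N.
  swr [:: a; b] [:: 0; 1; 2; 4; 5; 6; 7]%N.
  apply: eq_sw2 => a1 t; apply: eq_sw2 => z t'; apply: eq_sw2 => a5 a6.
  apply: eq_sw2 => b1 s; apply: eq_sw2 => b2 s'; apply: eq_sw2 => b3 s''.
  apply: eq_sw2 => y b7.
  refine (etrans _ (@sw2_counit_rl _ _ _ (fun b4 a4 =>
    ((r (S b2) a1 : k) * r b3 a4 * r a6 (S b1 * b7)) *: (b4 * a5)) y z _)); last by lin.
  apply: eq_sw2 => b4 p; apply: eq_sw2 => q a4.
  by rewrite -(rSr_inv hr); expand.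
transitivity (\Δ_(a1, a2 <- a) \Δ_(b1, b2, b3 <- b) (r a2 (S b1 * b3) : k) *: (b2 * a1)).
  sw [:: a; b] [:: 0; 2; 3; 3; 0; 4; 0]%N.
  swr [:: a; b] [:: 0; 2; 3]%N.
  apply: eq_sw2 => z a4; apply: eq_sw2 => b1 s; apply: eq_sw2 => y b5.
  refine (etrans _ (@sw2_counit_ll _ _ _ (fun b4 a3 =>
    (r a4 (S b1 * b5) : k) *: (b4 * a3)) y z _)); last by lin.
  apply: eq_sw2 => x b4; apply: eq_sw2 => q a3.
  by rewrite -(rSl_invl hr); expand.
transitivity (\Δ_(a1, t <- a) \Δ_(b1, b2, b3 <- b) \Δ_(a2, a3 <- t)
  ((r a2 b3 : k) * r a3 (S b1)) *: (b2 * a1)).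
  by do 3!peel; rewrite r_mulr; expand.
rewrite /tmul; sw [:: a; b] [:: 0; 2; 0; 4]%N; swr [:: a; b] [:: 0; 2; 0; 4]%N.
apply: eq_sw2 => p a3; apply: eq_sw2 => b1 q.
by by_id (@rcross _ _ _ hr _ (fun z => (r a3 (S b1) : k) *: z) p q ltac:(lin)).
Qed.

(** * The Drinfeld functional and the inverse of the antipode *)

(** The functional u of the introductory comment and its convolution inverse. *)
Definition drin (c : H) : k^o := \Δ_(c1, c2 <- c) r c1 (S c2).
Definition drinV (c : H) : k^o := \Δ_(c1, c2 <- c) r (S (S c1)) c2.
Lemma drin_lin : islin drin. Proof. by rewrite /drin; lin. Qed.
Lemma drinV_lin : islin drinV. Proof. by rewrite /drinV; lin. Qed.

(** Insert c_2 S(c_3) between the two legs of c in u(c), and cross by [rcross_Sr]. *)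
Lemma drin_unit U (L : H -> U) c : islin L ->
  (drin c : k) *: L 1 = \Δ_(c1, c2, c3 <- c) (drin c2 : k) *: L (S c3 * c1).
Proof.
move=> lL.
transitivity (\Δ_(c1, t <- c) \Δ_(x, c4 <- t) \Δ_(c2, c3 <- x)
  (r c1 (S c4) : k) *: L (c2 * S c3)).
  rewrite /drin sw2_scalel; apply: eq_sw2 => c1 t.
  by rewrite (@Sr_l _ _ _ (fun z c4 => (r c1 (S c4) : k) *: L z)) //; lin.
transitivity (\Δ_(x, y <- c) \Δ_(c1, c2 <- x) \Δ_(c3, c4 <- y)
  (r c2 (S c3) : k) *: L (S c4 * c1)).
  sw [:: c] [:: 0; 0; 2]%N; apply: eq_sw2 => x y.
  exact: (esym (rcross_Sr hr _ _ lL)).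
by sw [:: c] [:: 0; 1; 1]%N; rewrite /drin; expand.
Qed.

(** Multiply [drin_unit] by S^2(c_4) on the left, where S^2(c_4) S(c_3) = S(c_3 S(c_4))
    cancels. *)
Lemma drin_S2 U (L : H -> U) c : islin L ->
  \Δ_(c1, c2 <- c) (drin c1 : k) *: L (S (S c2)) = \Δ_(c1, c2 <- c) (drin c2 : k) *: L c1.
Proof.
have ldrin := drin_lin; move=> lL.
transitivity (\Δ_(x, c4 <- c) \Δ_(c1, c2, c3 <- x)
  (drin c2 : k) *: L (S (S c4) * (S c3 * c1))).
  apply: eq_sw2 => x c4; rewrite -(@drin_unit _ (fun z => L (S (S c4) * z))); last by lin.
  by rewrite mulr1.
sw [:: c] [:: 0; 1; 2]%N; apply: eq_sw2 => c1 y.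
transitivity (\Δ_(c2, t <- y) \Δ_(c3, c4 <- t) (drin c2 : k) *: L (S (c3 * S c4) * c1)).
  by do 2!peel; rewrite SM !mulrA.
rewrite (@Sr_r _ _ _ (fun c2 z => (drin c2 : k) *: L (S z * c1))); last by lin.
by rewrite S1 mul1r.
Qed.

(** By [drin_S2] the product u(c_1) r(S^2 c_2, c_3) equals u(c_2) r(c_1, c_3), that
    is, r(c_1, c_4) r(c_2, S c_3), where r cancels. *)
Lemma drin_mulV c : \Δ_(c1, c2 <- c) ((drin c1 : k) * drinV c2 : k^o) = eps c.
Proof.
have ldrin := drin_lin.
transitivity (\Δ_(x, c3 <- c) \Δ_(c1, c2 <- x) ((drin c2 : k) * r c1 c3 : k^o)).
  transitivity (\Δ_(x, c3 <- c) \Δ_(c1, c2 <- x) ((drin c1 : k) * r (S (S c2)) c3 : k^o)).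
    swr [:: c] [:: 0; 1]%N; rewrite /drinV; peel; rewrite sw2_kmulr.
    by [].
  apply: eq_sw2 => x c3.
  exact: (@drin_S2 k^o (fun z => r z c3) x ltac:(lin)).
transitivity (\Δ_(x, y <- c) \Δ_(c1, c2 <- x) \Δ_(c3, c4 <- y)
  ((r c1 c4 : k) * r c2 (S c3) : k^o)).
  swr [:: c] [:: 0; 0; 1]%N; do 2!peel; rewrite /drin sw2_kmull; peel; exact: mulrC.
transitivity (\Δ_(x, y <- c) ((eps x : k) *: eps y)).
  by do 1!peel; rewrite (rSr_invl hr).
by apply: (@sw2_counitl _ _ k^o (@eps k H)); lin.
Qed.

Lemma drinSS c : drin (S (S c)) = drin c.
Proof.
rewrite /drin sw2_S; last by lin.
rewrite sw2_S; last by lin.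
by peel; rewrite !(rSS hr).
Qed.

Lemma drinVSS c : drinV (S (S c)) = drinV c.
Proof.
rewrite /drinV sw2_S; last by lin.
rewrite sw2_S; last by lin.
by peel; rewrite !(rSS hr).
Qed.

Definition S2inv (c : H) : H := \Δ_(c1, c2, c3 <- c) ((drin c1 : k) * drinV c3) *: c2.

Lemma S2inv_lin : islin S2inv.
Proof. have ldrin := drin_lin; have ldrinV := drinV_lin; rewrite /S2inv; lin. Qed.

Lemma drin_conj_S2 U (L : H -> U) c : islin L ->
  \Δ_(c1, c2, c3 <- c) ((drin c1 : k) * drinV c3) *: L (S (S c2)) = L c.
Proof.
have ldrin := drin_lin; have ldrinV := drinV_lin; move=> lL.
sw [:: c] [:: 0; 0]%N.
transitivity (\Δ_(x, c3 <- c) \Δ_(c1, c2 <- x) (drin c2 : k) *: ((drinV c3 : k) *: L c1)).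
  apply: eq_sw2 => x c3.
  rewrite -(@drin_S2 _ (fun z => (drinV c3 : k) *: L z)); last by lin.
  by expand.
sw [:: c] [:: 0; 1]%N.
rewrite -[RHS](sw2_counitr _ lL); apply: eq_sw2 => c1 t.
by rewrite -drin_mulV; expand.
Qed.

Lemma SS_S2inv c : S (S (S2inv c)) = c.
Proof.
rewrite -[RHS](@drin_conj_S2 _ (fun z => z)); last by lin.
have lS2 : islin (fun z : H => S (S z)) by lin.
rewrite /S2inv (sw2_comp _ _ lS2); peel; rewrite (sw2_comp _ _ lS2); peel.
by rewrite (islinZ _ _ lS2).
Qed.

(** Since u and its inverse are invariant under S^2, by [rSS], the map [S2inv]
    commutes with S^2, and [drin_conj_S2] applies again. *)
Lemma S2inv_SS c : S2inv (S (S c)) = c.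
Proof.
have ldrin := drin_lin; have ldrinV := drinV_lin.
rewrite -[RHS](@drin_conj_S2 _ (fun z => z)); last by lin.
transitivity (\Δ_(x, y <- c) \Δ_(c2, c3 <- y)
  ((drin (S (S x)) : k) * drinV (S (S c3))) *: (S (S c2))); last first.
  by do 2!peel; rewrite drinSS drinVSS.
rewrite /S2inv sw2_S; last by lin.
rewrite sw2_S; last by lin.
peel; rewrite sw2_S; last by lin.
by rewrite sw2_S //; lin.
Qed.

Definition Sinv (c : H) : H := S (S2inv c).

Lemma Sinv_lin : islin Sinv.
Proof. have lt := S2inv_lin; rewrite /Sinv; lin. Qed.

Lemma S_Sinv c : S (Sinv c) = c. Proof. exact: SS_S2inv. Qed.
Lemma Sinv_S c : Sinv (S c) = c.
Proof. by rewrite -[c]S_Sinv /Sinv S2inv_SS. Qed.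
End BraidedCommutativity.

(** * Balanced tensor products *)

Section TensorExt.
Variables (k : fieldType) (V W U : lmodType k).

Lemma tens_ext (f g : (V ⊗ W)%type -> U) : islin f -> islin g ->
  (forall x y, f (x ⊗ y) = g (x ⊗ y)) -> forall t, f t = g t.
Proof.
move=> lf lg fg t; have [s ->] := tens_span t.
elim: s => [|p s IH]; last first.
  by rewrite big_cons lf lg fg IH.
rewrite big_nil; have z (h : (V ⊗ W)%type -> U) : islin h -> h 0 = 0.
  by move=> lh; have := islinZ 0 0 lh; rewrite !scale0r.
by rewrite !z.
Qed.

Lemma tlift_lin (f : V -> W -> U) : bilinear_map f -> islin (tlift f).
Proof. exact: tlift_linear. Qed.

Lemma tlift_id (t : (V ⊗ W)%type) : tlift (fun x y => x ⊗ y) t = t.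
Proof.
have [s ->] := tens_span t.
have lT : islin (tlift (@tens k V W)) by apply: tlift_linear; apply: tens_bilinear.
elim: s => [|p s IH]; last by rewrite big_cons lT IH tlift_tens //; apply: tens_bilinear.
by rewrite big_nil; have := islinZ 0 0 lT; rewrite !scale0r.
Qed.
End TensorExt.

Section Balanced.
Variables (k : fieldType) (B V W : lmodType k) (r : B -> V -> V) (l : B -> W -> W).
Local Notation T := (btensor r l).
Local Notation "x ⊙ y" := (btens r l x y) (at level 40, left associativity).

Definition isbal (U : lmodType k) (f : V -> W -> U) : Prop :=
  forall b x y, f (r b x) y = f x (l b y).

Lemma bclass_lin : islin (bclass r l).
Proof. exact: lclass_linear. Qed.

Lemma btens_bilinear : bilinear_map (btens r l).
Proof.
by apply: bilinI => ?; rewrite /btens; apply: (lin_comp bclass_lin); lin.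
Qed.

Lemma btens_bal : isbal (btens r l).
Proof.
by move=> b x y; apply/lclass_eqP; apply: lspan_gen; exists b, x, y.
Qed.

Lemma bclass_surj (t : T) : exists u, t = bclass r l u.
Proof. by exists (repr t); rewrite /bclass lclass_repr. Qed.

Lemma blift_lin (U : lmodType k) (f : V -> W -> U) :
  bilinear_map f -> isbal f -> islin (blift f : T -> U).
Proof.
move=> bf balf a x y; have [u ->] := bclass_surj x; have [v ->] := bclass_surj y.
by rewrite -bclass_lin !blift_class //; apply: tlift_linear.
Qed.

Lemma blift_tens (U : lmodType k) (f : V -> W -> U) x y :
  bilinear_map f -> isbal f -> blift f (x ⊙ y) = f x y.
Proof. by move=> bf balf; rewrite blift_class // tlift_tens. Qed.

Lemma blift_comp (U U' : lmodType k) (L : U -> U') (f : V -> W -> U) (t : T) :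
  islin L -> L (blift f t) = blift (fun x y => L (f x y)) t.
Proof. exact: tlift_comp. Qed.

Lemma btens_ext (U : lmodType k) (f g : T -> U) : islin f -> islin g ->
  (forall x y, f (x ⊙ y) = g (x ⊙ y)) -> forall t, f t = g t.
Proof.
move=> lf lg fg t; have [u ->] := bclass_surj t.
apply: (@tens_ext _ _ _ _ (fun u => f (bclass r l u)) (fun u => g (bclass r l u))).
- exact: (lin_comp lf bclass_lin).
- exact: (lin_comp lg bclass_lin).
- exact: fg.
Qed.

Lemma eq_blift (U : lmodType k) (f g : V -> W -> U) (t : T) :
  (forall x y, f x y = g x y) -> blift f t = blift g t.
Proof. exact: eq_tlift. Qed.
End Balanced.

(** * The smash product *)

Section Action.
Variables (k : fieldType) (H : hopfAlgType k) (B : lmodType k) (D : dy_algebra_data H B).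
Hypothesis hD : is_braided_commutative_algebra D.
Variable Si : H -> H.
Hypotheses (lSi : islin Si) (S_Si : forall c, S (Si c) = c) (Si_S : forall c, Si (S c) = c).
Implicit Types U : lmodType k.

(* L, and BT and DT below, name the vector space structures, not their carriers. *)
Local Notation L := (Defs_tensor__canonical__GRing_Lmodule B H).
Local Notation m := (dy_mul D).
Local Notation one := (dy_one D).
Local Notation act := (dy_act D).
(* The coaction, and later the other structure maps of the bialgebroid, are
   variables with a defining equation: computations then use only their values on
   generators. *)
Variables (co : B -> L) (co_def : co = (fun b => dy_coact D b)).
Local Notation "'\cw_' ( x , y <- b ) E" := (tlift (fun x y => E) (co b))
  (at level 41, x name, y name, b at level 99, E at level 41, right associativity).
Local Notation "a # h" := (@tens k B H a h) (at level 40, left associativity).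

Let bm : bilinear_map m := alg_bilinear (bca_algebra hD).
Let ba : bilinear_map act := dy_act_bilinear (bca_module hD).
Let lco : islin co. Proof. rewrite co_def; exact: dy_coact_linear (bca_module hD). Qed.
Let mA : associative m := alg_mulA (bca_algebra hD).
Let m1l a : m one a = a := alg_mul1l (bca_algebra hD) a.
Let m1r a : m a one = a := alg_mul1r (bca_algebra hD) a.
Let act1 b : act b 1 = b := dy_act1 (bca_module hD) b.
Let actM b h g : act b (h * g) = act (act b h) g := dy_actM (bca_module hD) b h g.
Let act_one h : act one h = (eps h : k) *: one := bca_act1 hD h.
Let act_mul a b h : act (m a b) h = \Δ_(h1, h2 <- h) m (act a h1) (act b h2) :=
  bca_actM hD a b h.
Let co_one : co one = one # 1. Proof. rewrite co_def; exact: bca_coact1 hD. Qed.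
Let co_counit b : \cw_(b0, b1 <- b) (eps b1 : k) *: b0 = b.
Proof. rewrite co_def; exact: dy_coact_counit (bca_module hD) b. Qed.
Let co_mul a b : co (m a b) = \cw_(a0, a1 <- a) \cw_(b0, b1 <- b) (m a0 b0 # (a1 * b1)).
Proof. rewrite co_def; exact: bca_coactM hD a b. Qed.
Let mC a b : m a b = \cw_(b0, b1 <- b) m b0 (act a b1).
Proof. rewrite co_def; exact: bca_comm hD a b. Qed.

Lemma compat U (F : B -> H -> U) b h : bilinear_map F ->
  \Δ_(h1, h2 <- h) \cw_(c0, c1 <- act b h2) F c0 (h1 * c1) =
  \cw_(b0, b1 <- b) \Δ_(h1, h2 <- h) F (act b0 h1) (b1 * h2).
Proof.
move=> bF; have lF := tlift_lin bF.
have e : \Δ_(h1, h2 <- h) \cw_(c0, c1 <- act b h2) (c0 # (h1 * c1)) =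
  \cw_(b0, b1 <- b) \Δ_(h1, h2 <- h) (act b0 h1 # (b1 * h2)).
  rewrite co_def; exact: (dy_compat (bca_module hD) b h).
move: e => /(congr1 (tlift F)) e; refine (etrans _ (etrans e _)).
  rewrite (sw2_comp _ _ lF); peel; rewrite (tlift_comp _ _ lF).
  by apply: eq_tlift => c0 c1; rewrite tlift_tens.
rewrite (tlift_comp _ _ lF); apply: eq_tlift => b0 b1.
by rewrite (sw2_comp _ _ lF); peel; rewrite tlift_tens.
Qed.

Lemma coA U (F : B -> H -> H -> U) b :
  (forall b x, islin (F b x)) -> (forall x, bilinear_map (fun b y => F b y x)) ->
  \cw_(b0, b1 <- b) \cw_(c0, c1 <- b0) F c0 c1 b1 =
  \cw_(b0, b1 <- b) \Δ_(h1, h2 <- b1) F b0 h1 h2.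
Proof.
move=> l1 l2; pose G (u : (B ⊗ H)%type) (x : H) := tlift (fun b y => F b y x) u.
have bG : bilinear_map G.
  apply: bilinI => [x|u]; first exact: tlift_lin.
  by rewrite /G; apply: lin_tlift.
have lG := tlift_lin bG.
have e : \cw_(b0, b1 <- b) (co b0 ⊗ b1) =
  \cw_(b0, b1 <- b) \Δ_(h1, h2 <- b1) ((b0 # h1) ⊗ h2).
  rewrite co_def; exact: (dy_coactA (bca_module hD) b).
move: e => /(congr1 (tlift G)) e; refine (etrans _ (etrans e _)).
  rewrite (tlift_comp _ _ lG); apply: eq_tlift => b0 b1.
  by apply/esym; apply: tlift_tens.
rewrite (tlift_comp _ _ lG); apply: eq_tlift => b0 b1.
rewrite (sw2_comp _ _ lG); peel.
by apply: (etrans (tlift_tens _ _ bG)); apply: tlift_tens.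
Qed.

Lemma co_counitE U (f : B -> U) b : islin f -> \cw_(b0, b1 <- b) (eps b1 : k) *: f b0 = f b.
Proof.
move=> lf; rewrite -{2}[b]co_counit (tlift_comp _ _ lf).
by apply: eq_tlift => b0 b1; rewrite (islinZ _ _ lf).
Qed.

Lemma coE b : co b = \cw_(b0, b1 <- b) (b0 # b1).
Proof. by rewrite tlift_id. Qed.

Variables (am : L -> L -> L) (am_def : am = (fun x y => tlift (fun a h => tlift (fun b g =>
  \Δ_(h1, h2 <- h) (m a (act b h1) # (g * h2))) y) x)).
Local Notation "x ∙ y" := (am x y) (at level 40, left associativity).
Variables (sr : B -> L) (sr_def : sr = (fun b => b # 1)).

Lemma am_bilinear : bilinear_map am.
Proof. by rewrite am_def; lin. Qed.
Let bam := am_bilinear.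

Lemma am_tens a h b g :
  (a # h) ∙ (b # g) = \Δ_(h1, h2 <- h) (m a (act b h1) # (g * h2)).
Proof.
rewrite am_def; refine (etrans (tlift_tens _ _ _) _); first by lin.
by apply: tlift_tens; lin.
Qed.

Lemma srE b : sr b = b # 1. Proof. by rewrite sr_def. Qed.
Lemma sr_lin : islin sr. Proof. by rewrite sr_def; lin. Qed.
Let lsr := sr_lin.

(** By definition t(b)(a # h) = b_(0) (a ◁ b_(1)) # h b_(2), and braided
    commutativity turns b_(0) (a ◁ b_(1)) into a b_(0). *)
Lemma tgt_am b a h : co b ∙ (a # h) = \cw_(b0, b1 <- b) (m a b0 # (h * b1)).
Proof.
rewrite {1}coE (@tlift_comp _ _ _ _ _ (fun z => am z (a # h))); last by lin.
transitivity (\cw_(b0, b1 <- b) \Δ_(h1, h2 <- b1) (m b0 (act a h1) # (h * h2))).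
  by apply: eq_tlift => b0 b1; apply: am_tens.
rewrite -(@coA _ (fun c0 c1 x => m c0 (act a c1) # (h * x))); try by move=> *; lin.
apply: eq_tlift => b0 b1; rewrite mC.
by rewrite (@tlift_comp _ _ _ _ _ (fun z => z # (h * b1))); last by lin.
Qed.

Lemma src_am b a h : sr b ∙ (a # h) = m b a # h.
Proof. by rewrite srE am_tens sw2_1 ?act1 ?mulr1 //; lin. Qed.

Lemma am_src a h b : (a # h) ∙ sr b = \Δ_(h1, h2 <- h) (m a (act b h1) # h2).
Proof. by rewrite srE am_tens; peel; rewrite mul1r. Qed.

Lemma am_tgt a h b :
  (a # h) ∙ co b = \cw_(b0, b1 <- b) \Δ_(h1, h2 <- h) (m a (act b0 h1) # (b1 * h2)).
Proof.
rewrite {1}coE (@tlift_comp _ _ _ _ _ (am (a # h))); last by lin.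
by apply: eq_tlift => b0 b1; apply: am_tens.
Qed.

Lemma one_am g b h : (one # g) ∙ (b # h) = \Δ_(g1, g2 <- g) (act b g1 # (h * g2)).
Proof. by rewrite am_tens; peel; rewrite m1l. Qed.

Lemma am_one a h g : (a # h) ∙ (one # g) = a # (g * h).
Proof.
rewrite am_tens; transitivity (\Δ_(h1, h2 <- h) (eps h1 : k) *: (a # (g * h2))).
  by peel; rewrite act_one (islinZ _ _ (proj2 bm a)) m1r tensZl.
by apply: (@sw2_counitl _ _ _ (fun h => a # (g * h))); lin.
Qed.

Lemma am1l x : (one # 1) ∙ x = x.
Proof.
apply: (@tens_ext _ _ _ _ (am (one # 1)) (fun x => x)); try lin.
by move=> a h; rewrite -srE src_am m1l.
Qed.

Lemma am1r x : x ∙ (one # 1) = x.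
Proof.
apply: (@tens_ext _ _ _ _ (fun x => am x (one # 1)) (fun x => x)); try lin.
by move=> a h; rewrite am_one mul1r.
Qed.

Lemma amA : associative am.
Proof.
move=> x y z; move: x; apply: tens_ext; try lin; move=> a h; move: y.
apply: tens_ext; try lin; move=> b g; move: z.
apply: tens_ext; try lin; move=> c f.
transitivity (\Δ_(h1, h2, h3 <- h) \Δ_(g1, g2 <- g)
  (m (m a (act b h1)) (act c (g1 * h2)) # (f * g2 * h3))).
  rewrite (am_tens b) (sw2_comp _ _ (proj2 bam _)).
  transitivity (\Δ_(g1, g2 <- g) \Δ_(p, h3 <- h) \Δ_(h1, h2 <- p)
    (m (m a (act b h1)) (act c (g1 * h2)) # (f * g2 * h3))).
    peel; rewrite am_tens; peel; rewrite act_mul (sw2_comp _ _ (proj2 bm _)) sw2_tensl.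
    by peel; rewrite mA actM.
  by sw [:: h; g] [:: 0; 1; 3]%N.
rewrite (am_tens a) (@sw2_comp _ _ _ _ (fun z => am z (c # f))); last by lin.
transitivity (\Δ_(h1, t <- h) \Δ_(g1, g2 <- g) \Δ_(h2, h3 <- t)
    (m (m a (act b h1)) (act c (g1 * h2)) # (f * g2 * h3))).
  by sw [:: h; g] [:: 0; 2; 1]%N.
peel; rewrite am_tens sw2_mul; last by lin.
by do 2!peel; rewrite mulrA.
Qed.

Lemma srM a b : sr (m a b) = sr a ∙ sr b.
Proof. by rewrite [sr b]srE src_am srE. Qed.

Lemma coM a b : co (m a b) = co b ∙ co a.
Proof.
rewrite co_mul {2}(coE a) (tlift_comp _ _ (proj2 bam _)).
by apply: eq_tlift => a0 a1; rewrite tgt_am.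
Qed.

Lemma sr_co a b : sr a ∙ co b = co b ∙ sr a.
Proof.
rewrite [in RHS]srE tgt_am {1}coE (tlift_comp _ _ (proj2 bam _)); apply: eq_tlift => b0 b1.
by rewrite src_am mul1r.
Qed.

(** * The left bialgebroid *)

Local Notation BT := (Defs_btensor__canonical__GRing_Lmodule
  (fun (b : B) (x : L) => am (co b) x) (fun (b : B) (y : L) => am (sr b) y)).
Variables (bt : L -> L -> BT)
  (bt_def : bt = btens (fun b x => am (co b) x) (fun b y => am (sr b) y)).
Local Notation bal f := (isbal (fun b x => am (co b) x) (fun b y => am (sr b) y) f).

Lemma bt_bilinear : bilinear_map bt. Proof. rewrite bt_def; exact: btens_bilinear. Qed.
Let bbt := bt_bilinear.
Lemma bt_bal b x y : bt (co b ∙ x) y = bt x (sr b ∙ y).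
Proof.
rewrite bt_def.
exact: (@btens_bal k B L L (fun b x => am (co b) x) (fun b y => am (sr b) y)).
Qed.

(** Because b # g = s(b)(1 # g), the elements x ⊗ (1 # g) span L ⊗_B L. *)
Lemma btE x b g : bt x (b # g) = bt (co b ∙ x) (one # g).
Proof. by rewrite bt_bal src_am m1r. Qed.

Variables (Dl : L -> BT) (Dl_def : Dl =
  (fun x => tlift (fun a h => \Δ_(h1, h2 <- h) bt (a # h1) (one # h2)) x)).
Lemma Dl_lin : islin Dl. Proof. by rewrite Dl_def; lin. Qed.
Let lDl := Dl_lin.
Lemma Dl_tens a h : Dl (a # h) = \Δ_(h1, h2 <- h) bt (a # h1) (one # h2).
Proof. by rewrite Dl_def; apply: tlift_tens; lin. Qed.

Variables (cnt : L -> B) (cnt_def : cnt = (fun x => tlift (fun a h => (eps h : k) *: a) x)).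
Lemma cnt_lin : islin cnt. Proof. by rewrite cnt_def; lin. Qed.
Let lcnt := cnt_lin.
Lemma cnt_tens a h : cnt (a # h) = (eps h : k) *: a.
Proof. by rewrite cnt_def; apply: tlift_tens; lin. Qed.

Section Lift.
Variables (U : lmodType k) (f : L -> L -> U).
Hypotheses (bf : bilinear_map f) (balf : bal f).
Lemma lift_lin : islin (blift f : BT -> U). Proof. exact: blift_lin. Qed.
Lemma lift_bt x y : blift f (bt x y) = f x y. Proof. by rewrite bt_def; apply: blift_tens. Qed.
Lemma blift_Dl_lin : islin (fun x => blift f (Dl x)).
Proof. exact: (lin_comp lift_lin lDl). Qed.
Lemma blift_Dl a h : blift f (Dl (a # h)) = \Δ_(h1, h2 <- h) f (a # h1) (one # h2).
Proof. by rewrite Dl_tens (sw2_comp _ _ lift_lin); peel; apply: lift_bt. Qed.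
End Lift.

Lemma lift_comp U U' (G : U -> U') (f : L -> L -> U) (t : BT) :
  islin G -> G (blift f t) = blift (fun x y => G (f x y)) t.
Proof. exact: blift_comp. Qed.

Lemma L_ext U (f g : L -> U) : islin f -> islin g ->
  (forall a h, f (a # h) = g (a # h)) -> forall x, f x = g x.
Proof. exact: tens_ext. Qed.

Lemma Dl_src b x : Dl (sr b ∙ x) = blift (fun x1 x2 => bt (sr b ∙ x1) x2) (Dl x).
Proof.
have bf : bilinear_map (fun x1 x2 => bt (sr b ∙ x1) x2) by lin.
have balf : bal (fun x1 x2 => bt (sr b ∙ x1) x2).
  by move=> c y z; rewrite amA sr_co -amA bt_bal.
move: x; apply: L_ext; [lin | exact: blift_Dl_lin |] => a h.
by rewrite src_am Dl_tens (blift_Dl bf balf); peel; rewrite src_am.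
Qed.

(** By [tgt_am] the left side is (a b_(0) # h_1 b_(1)) ⊗ (1 # h_2 b_(2)); on the
    right the factor b_(0) of t(b)(1 # h_2) = b_(0) # h_2 b_(1) is moved across
    the tensor by [btE], which gives the same. *)
Lemma Dl_tgt b x : Dl (co b ∙ x) = blift (fun x1 x2 => bt x1 (co b ∙ x2)) (Dl x).
Proof.
have bf : bilinear_map (fun x1 x2 => bt x1 (co b ∙ x2)) by lin.
have balf : bal (fun x1 x2 => bt x1 (co b ∙ x2)).
  by move=> c y z; rewrite amA -sr_co -amA bt_bal.
move: x; apply: L_ext; [lin | exact: blift_Dl_lin |] => a h.
rewrite tgt_am (tlift_comp _ _ lDl) (blift_Dl bf balf).
transitivity (\Δ_(h1, h2 <- h) \cw_(b0, b1 <- b) \Δ_(x, y <- b1)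
    bt (m a b0 # (h1 * x)) (one # (h2 * y))).
  rewrite [RHS]tlift_swap; apply: eq_tlift => b0 b1.
  by rewrite Dl_tens sw2_mul //; lin.
peel; rewrite tgt_am (tlift_comp _ _ (proj2 bbt _)).
rewrite -(@coA _ (fun b0 x y => bt (m _ b0 # (_ * x)) (one # (_ * y))));
  try by move=> *; lin.
apply: eq_tlift => b0 b1; rewrite m1l btE tgt_am.
by rewrite (@tlift_comp _ _ _ _ _ (fun z => bt z _)); last by lin.
Qed.

Lemma cnt_src b x : cnt (sr b ∙ x) = m b (cnt x).
Proof.
move: x; apply: L_ext; try lin; move=> a h.
by rewrite src_am !cnt_tens (islinZ _ _ (proj2 bm b)).
Qed.

Lemma cnt_tgt b x : cnt (co b ∙ x) = m (cnt x) b.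
Proof.
move: x; apply: L_ext; try lin; move=> a h.
rewrite tgt_am (tlift_comp _ _ lcnt) cnt_tens.
rewrite -(@co_counitE _ (m ((eps h : k) *: a))); last by lin.
apply: eq_tlift => b0 b1.
by rewrite cnt_tens epsM (@islinZ _ _ _ (fun z => m z b0)) ?scalerA 1?mulrC //; lin.
Qed.

Lemma cnt_counitl x : blift (fun x1 x2 => sr (cnt x1) ∙ x2) (Dl x) = x.
Proof.
have bf : bilinear_map (fun x1 x2 => sr (cnt x1) ∙ x2) by lin.
have balf : bal (fun x1 x2 => sr (cnt x1) ∙ x2).
  by move=> c y z; rewrite cnt_tgt srM amA.
move: x; apply: L_ext; [exact: blift_Dl_lin | lin |] => a h.
rewrite (blift_Dl bf balf) -[RHS](@sw2_counitl _ _ _ (fun h => a # h)); last by lin.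
by peel; rewrite cnt_tens src_am m1r tensZl.
Qed.

Lemma cnt_counitr x : blift (fun x1 x2 => co (cnt x2) ∙ x1) (Dl x) = x.
Proof.
have bf : bilinear_map (fun x1 x2 => co (cnt x2) ∙ x1) by lin.
have balf : bal (fun x1 x2 => co (cnt x2) ∙ x1).
  by move=> c y z; rewrite cnt_src coM amA.
move: x; apply: L_ext; [exact: blift_Dl_lin | lin |] => a h.
rewrite (blift_Dl bf balf) -[RHS](@sw2_counitr _ _ _ (fun h => a # h)); last by lin.
peel; rewrite cnt_tens (islinZ _ _ lco) co_one.
by rewrite (@islinZ _ _ _ (fun z => am z _)) ?am1l //; lin.
Qed.

(** On a # h the right side is (a # h_1) ⊗ (b ◁ h_2 # h_3).  Moving b ◁ h_2 to the
    first factor by [btE] yields a (b ◁ h_2)_(0) # h_1 (b ◁ h_2)_(1) there, and the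
    Drinfeld–Yetter condition identifies it with (a # p) t(b), where p collects
    h_1 and h_2. *)
Lemma takeuchi x b : blift (fun x1 x2 => bt (x1 ∙ co b) x2) (Dl x) =
  blift (fun x1 x2 => bt x1 (x2 ∙ sr b)) (Dl x).
Proof.
have b1 : bilinear_map (fun x1 x2 => bt (x1 ∙ co b) x2) by lin.
have b2 : bilinear_map (fun x1 x2 => bt x1 (x2 ∙ sr b)) by lin.
have bal1 : bal (fun x1 x2 => bt (x1 ∙ co b) x2).
  by move=> c y z; rewrite -amA bt_bal.
have bal2 : bal (fun x1 x2 => bt x1 (x2 ∙ sr b)).
  by move=> c y z; rewrite -amA bt_bal.
move: x; apply: L_ext; [exact: blift_Dl_lin | exact: blift_Dl_lin |] => a h.
rewrite (blift_Dl b1 bal1) (blift_Dl b2 bal2); symmetry.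
transitivity (\Δ_(h1, h2, h3 <- h) \cw_(c0, c1 <- act b h2) bt (m a c0 # (h1 * c1)) (one # h3)).
  apply: eq_sw2 => h1 t; rewrite am_src (sw2_comp _ _ (proj2 bbt _)).
  apply: eq_sw2 => h2 h3; rewrite m1l btE tgt_am.
  by rewrite (@tlift_comp _ _ _ _ _ (fun z => bt z _)); last by lin.
sw [:: h] [:: 0; 0]%N; apply: eq_sw2 => p h3.
rewrite (@compat _ (fun c0 z => bt (m a c0 # z) (one # h3))); last by lin.
rewrite am_tgt (@tlift_comp _ _ _ _ _ (fun z => bt z _)); last by lin.
apply: eq_tlift => b0 b1'; rewrite (@sw2_comp _ _ _ _ (fun z => bt z _)) //; lin.
Qed.

Lemma Dl_one : Dl (one # 1) = bt (one # 1) (one # 1).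
Proof. by rewrite Dl_tens sw2_1 //; lin. Qed.

Lemma cnt_one : cnt (one # 1) = one.
Proof. by rewrite cnt_tens eps1 scale1r. Qed.

Lemma cntM_src x y : cnt (x ∙ sr (cnt y)) = cnt (x ∙ y).
Proof.
move: x; apply: L_ext; try lin; move=> a h; move: y; apply: L_ext; try lin; move=> b g.
rewrite cnt_tens am_src am_tens.
refine (etrans (sw2_comp _ _ lcnt) (etrans _ (esym (sw2_comp _ _ lcnt)))); peel.
rewrite !cnt_tens epsM (@islinZ _ _ _ (fun b => m a (act b _))) ?scalerA 1?mulrC //; lin.
Qed.

Lemma cntM_tgt x y : cnt (x ∙ co (cnt y)) = cnt (x ∙ y).
Proof.
move: x; apply: L_ext; try lin; move=> a h; move: y; apply: L_ext; try lin; move=> b g.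
rewrite cnt_tens (islinZ _ _ lco).
rewrite (islinZ _ _ (proj2 bam _)) (islinZ _ _ lcnt) am_tgt am_tens (tlift_comp _ _ lcnt).
refine (etrans _ (esym (sw2_comp _ _ lcnt))).
transitivity ((eps g : k) *: \Δ_(h1, h2 <- h) (eps h2 : k) *: m a (act b h1)).
  congr (_ *: _).
  rewrite -(@co_counitE _ (fun b => \Δ_(h1, h2 <- h) (eps h2 : k) *: m a (act b h1)));
    last by lin.
  apply: eq_tlift => b0 b1; rewrite (sw2_comp _ _ lcnt) sw2_scaler; peel.
  by rewrite cnt_tens epsM scalerA.
by rewrite sw2_scaler; peel; rewrite cnt_tens epsM scalerA.
Qed.

(** The factorwise right multiplication of Δ(x) by y_1 ⊗ y_2 is balanced in y_1, y_2
    by [takeuchi].  So the right side depends only on Δ(x) and Δ(y), and the claim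
    can be checked for x = a # h and y = b # g. *)
Lemma Dl_mul x y (u v : (L ⊗ L)%type) :
  bclass (fun b x => am (co b) x) (fun b y => am (sr b) y) u = Dl x ->
  bclass (fun b x => am (co b) x) (fun b y => am (sr b) y) v = Dl y ->
  Dl (x ∙ y) = tlift (fun x1 x2 => tlift (fun y1 y2 => bt (x1 ∙ y1) (x2 ∙ y2)) v) u.
Proof.
move=> eu ev.
pose K y1 y2 x1 x2 := bt (x1 ∙ y1) (x2 ∙ y2).
have bK y1 y2 : bilinear_map (K y1 y2) by rewrite /K; lin.
have balK y1 y2 : bal (K y1 y2) by move=> c z1 z2; rewrite /K -!amA bt_bal.
pose G z y1 y2 := blift (K y1 y2) (Dl z).
have bG z : bilinear_map (G z) by rewrite /G /K; lin.
have balG z : bal (G z).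
  move=> c y1 y2; rewrite /G.
  transitivity (blift (K y1 y2) (blift (fun x1 x2 => bt (x1 ∙ co c) x2) (Dl z))).
    rewrite (lift_comp _ _ (lift_lin (bK y1 y2) (balK y1 y2))); apply: eq_blift => x1 x2.
    by rewrite (lift_bt (bK y1 y2) (balK y1 y2)) /K amA.
  rewrite takeuchi (lift_comp _ _ (lift_lin (bK y1 y2) (balK y1 y2))).
  apply: eq_blift => x1 x2.
  by rewrite (lift_bt (bK y1 y2) (balK y1 y2)) /K amA.
transitivity (blift (G x) (Dl y)); last first.
  rewrite -ev (blift_class _ (bG x) (balG x)).
  transitivity (tlift (fun y1 y2 => tlift (fun x1 x2 => bt (x1 ∙ y1) (x2 ∙ y2)) u) v).
    by apply: eq_tlift => y1 y2; rewrite /G -eu (blift_class _ (bK y1 y2) (balK y1 y2)).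
  exact: tlift_swap.
move: y {ev v}; apply: L_ext; [lin | exact: (blift_Dl_lin (bG x) (balG x)) |] => b g.
rewrite (blift_Dl (bG x) (balG x)) /G.
move: x {eu u}; apply: L_ext.
- by lin.
- apply: lin_sw2 => g1 g2; exact: (blift_Dl_lin (bK _ _) (balK _ _)).
move=> a h.
transitivity (\Δ_(h1, h2, h3 <- h) \Δ_(g1, g2 <- g)
  bt (m a (act b h1) # (g1 * h2)) (one # (g2 * h3))).
  rewrite am_tens (sw2_comp _ _ lDl); peel.
  rewrite Dl_tens sw2_mul; last by lin.
  by rewrite sw2_swap.
transitivity (\Δ_(g1, g2 <- g) \Δ_(p, h3 <- h) \Δ_(h1, h2 <- p)
  bt (m a (act b h1) # (g1 * h2)) (one # (g2 * h3))).
  by sw [:: h; g] [:: 1; 0; 0]%N.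
apply: eq_sw2 => g1 g2; rewrite (blift_Dl (bK _ _) (balK _ _)); apply: eq_sw2 => p h3.
rewrite /K am_one am_tens.
by refine (esym (@sw2_comp _ _ _ _ (fun z => bt z (one # (g2 * h3))) _ _ _)); lin.
Qed.

Lemma Dl_mulr x y y1 y2 : Dl y = bt y1 y2 ->
  Dl (x ∙ y) = blift (fun x1 x2 => bt (x1 ∙ y1) (x2 ∙ y2)) (Dl x).
Proof.
move=> ey; have [u eu] := bclass_surj (Dl x).
rewrite (@Dl_mul x y u (y1 ⊗ y2)); [|exact: esym|by rewrite ey bt_def].
have bK : bilinear_map (fun x1 x2 => bt (x1 ∙ y1) (x2 ∙ y2)) by lin.
have balK : bal (fun x1 x2 => bt (x1 ∙ y1) (x2 ∙ y2)) by move=> c z1 z2; rewrite -!amA bt_bal.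
rewrite eu (blift_class _ bK balK); apply: eq_tlift => x1 x2.
by rewrite tlift_tens; last by lin.
Qed.

Lemma Dl_mul_tgt x b : Dl (x ∙ co b) = blift (fun x1 x2 => bt x1 (x2 ∙ co b)) (Dl x).
Proof.
rewrite (@Dl_mulr x (co b) (one # 1) (co b)).
  by apply: eq_blift => x1 x2; rewrite am1r.
rewrite -[in LHS](am1r (co b)) Dl_tgt Dl_one lift_bt ?am1r //; first by lin.
by move=> c y z; rewrite amA -sr_co -amA bt_bal.
Qed.

Lemma Dl_mul_src x b : Dl (x ∙ sr b) = blift (fun x1 x2 => bt (x1 ∙ sr b) x2) (Dl x).
Proof.
rewrite (@Dl_mulr x (sr b) (sr b) (one # 1)).
  by apply: eq_blift => x1 x2; rewrite am1r.
rewrite -[in LHS](am1r (sr b)) Dl_src Dl_one lift_bt ?am1r //; first by lin.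
by move=> c y z; rewrite amA sr_co -amA bt_bal.
Qed.

(* Coassociativity is proved for an arbitrary balanced trilinear map t3, which in
   the end is the universal one. *)
Section Triple.
Variables (T3 : lmodType k) (t3 : L -> L -> L -> T3).
Hypotheses
  (t3_lin1 : forall (T : lmodType k) (f : T -> L) y z, islin f -> islin (fun x => t3 (f x) y z))
  (t3_lin2 : forall (T : lmodType k) (f : T -> L) x z, islin f -> islin (fun y => t3 x (f y) z))
  (t3_lin3 : forall (T : lmodType k) (f : T -> L) x y, islin f -> islin (fun z => t3 x y (f z)))
  (t3_bal1 : forall b x y z, t3 (co b ∙ x) y z = t3 x (sr b ∙ y) z)
  (t3_bal2 : forall b x y z, t3 x (co b ∙ y) z = t3 x y (sr b ∙ z)).

Lemma Dl_coassoc x :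
  blift (fun x1 x2 => blift (fun y1 y2 => t3 y1 y2 x2) (Dl x1)) (Dl x) =
  blift (fun x1 x2 => blift (fun y1 y2 => t3 x1 y1 y2) (Dl x2)) (Dl x).
Proof.
have b1 z : bilinear_map (fun y1 y2 => t3 y1 y2 z).
  by apply: bilinI => w; [apply: (t3_lin1 _ _ (@lin_id _ L)) | apply: (t3_lin2 _ _ (@lin_id _ L))].
have b2 z : bilinear_map (fun y1 y2 => t3 z y1 y2).
  by apply: bilinI => w; [apply: (t3_lin2 _ _ (@lin_id _ L)) | apply: (t3_lin3 _ _ (@lin_id _ L))].
have c1 z : bal (fun y1 y2 => t3 y1 y2 z) by move=> b y1 y2; apply: t3_bal1.
have c2 z : bal (fun y1 y2 => t3 z y1 y2) by move=> b y1 y2; apply: t3_bal2.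
have B1 : bilinear_map (fun x1 x2 => blift (fun y1 y2 => t3 y1 y2 x2) (Dl x1)).
  apply: bilinI => [z|x1]; first exact: (blift_Dl_lin (b1 z) (c1 z)).
  by apply: lin_blift => y1 y2; apply: (t3_lin3 _ _ (@lin_id _ L)).
have B2 : bilinear_map (fun x1 x2 => blift (fun y1 y2 => t3 x1 y1 y2) (Dl x2)).
  apply: bilinI => [x2|z]; last exact: (blift_Dl_lin (b2 z) (c2 z)).
  by apply: lin_blift => y1 y2; apply: (t3_lin1 _ _ (@lin_id _ L)).
have C1 : bal (fun x1 x2 => blift (fun y1 y2 => t3 y1 y2 x2) (Dl x1)).
  move=> b x1 x2; rewrite Dl_tgt (lift_comp _ _ (lift_lin (b1 x2) (c1 x2))).
  by apply: eq_blift => y1 y2; rewrite (lift_bt (b1 x2) (c1 x2)) t3_bal2.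
have C2 : bal (fun x1 x2 => blift (fun y1 y2 => t3 x1 y1 y2) (Dl x2)).
  move=> b x1 x2; rewrite Dl_src (lift_comp _ _ (lift_lin (b2 x1) (c2 x1))).
  by apply: eq_blift => y1 y2; rewrite (lift_bt (b2 x1) (c2 x1)) t3_bal1.
move: x; apply: L_ext; [exact: (blift_Dl_lin B1 C1) | exact: (blift_Dl_lin B2 C2) |] => a h.
rewrite (blift_Dl B1 C1) (blift_Dl B2 C2).
transitivity (\Δ_(x, h3 <- h) \Δ_(h1, h2 <- x) t3 (a # h1) (one # h2) (one # h3)).
  by apply: eq_sw2 => x h3; rewrite (blift_Dl (b1 _) (c1 _)).
transitivity (\Δ_(h1, h2, h3 <- h) t3 (a # h1) (one # h2) (one # h3)).
  by sw [:: h] [:: 0; 1]%N.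
by apply: eq_sw2 => h1 t; rewrite (blift_Dl (b2 _) (c2 _)).
Qed.
End Triple.

(** * The Galois maps *)

(** Since the x ⊗ (1 # g) span L ⊗_B L by [btE], a map out of it should be given by
    any prescription P(x, g) there.  It is x ⊗ (b # g) |-> P(t(b)x, g), which is
    balanced because t is antimultiplicative. *)
Lemma bal_of_pure U (P : L -> H -> U) : bilinear_map P ->
  bilinear_map (fun x y : L => tlift (fun b g => P (co b ∙ x) g) y) /\
  bal (fun x y : L => tlift (fun b g => P (co b ∙ x) g) y).
Proof.
move=> bP; split; first by lin.
move=> c x y; move: y; apply: L_ext; try lin; move=> b g.
by rewrite src_am !tlift_tens ?coM ?amA //; lin.
Qed.

Lemma bal_of_pure_tens U (P : L -> H -> U) x b g : bilinear_map P ->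
  tlift (fun b g => P (co b ∙ x) g) (b # g) = P (co b ∙ x) g.
Proof. by move=> bP; apply: tlift_tens; lin. Qed.

Section Galois.
Variables (rD lD : B -> L -> L).
Local Notation DT := (Defs_btensor__canonical__GRing_Lmodule rD lD).
Variables (dt : L -> L -> DT) (dt_def : dt = btens rD lD).

Lemma dt_bilinear : bilinear_map dt. Proof. rewrite dt_def; exact: btens_bilinear. Qed.
Let bdt := dt_bilinear.
Lemma dt_bal b x y : dt (rD b x) y = dt x (lD b y).
Proof. by rewrite dt_def; apply: (@btens_bal k B L L rD lD). Qed.

Lemma dt_ext U (f g : DT -> U) : islin f -> islin g ->
  (forall x y, f (dt x y) = g (dt x y)) -> forall t, f t = g t.
Proof. rewrite dt_def; exact: btens_ext. Qed.

Lemma bt_ext U (f g : BT -> U) : islin f -> islin g ->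
  (forall x y, f (bt x y) = g (bt x y)) -> forall t, f t = g t.
Proof. rewrite bt_def; exact: btens_ext. Qed.

(** Both inverses are of the form of [bal_of_pure], so that one composite need only
    be tested on the elements z ⊗ (1 # g). *)
Lemma galois_bij (f : L -> L -> BT) (P : L -> H -> DT) :
  bilinear_map f -> isbal rD lD f -> bilinear_map P ->
  (forall z g, blift f (P z g) = bt z (one # g)) ->
  (forall x y, blift (fun x y : L => tlift (fun b g => P (co b ∙ x) g) y) (f x y) = dt x y) ->
  bijective (blift f : DT -> BT).
Proof.
move=> bf balf bP fP Pf; have [bQ balQ] := bal_of_pure bP.
have lf : islin (blift f : DT -> BT) by apply: blift_lin.
have lQ := lift_lin bQ balQ.
exists (blift (fun x y : L => tlift (fun b g => P (co b ∙ x) g) y)).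
  apply: (@dt_ext _ (fun t => blift (fun x y : L => tlift (fun b g => P (co b ∙ x) g) y)
    (blift f t)) (fun t => t)); [exact: (lin_comp lQ lf) | lin |] => x y.
  rewrite -[RHS]Pf; congr (blift _ _); rewrite dt_def; exact: blift_tens.
apply: (@bt_ext _ (fun t => blift f (blift (fun x y : L =>
  tlift (fun b g => P (co b ∙ x) g) y) t)) (fun t => t)); [exact: (lin_comp lf lQ) | lin |].
move=> x y; rewrite (lift_bt bQ balQ); move: y.
apply: L_ext; [by apply: (lin_comp lf); lin | by lin |] => b g.
rewrite btE -(fP (co b ∙ x) g); refine (congr1 (blift f) _).
exact: bal_of_pure_tens.
Qed.
End Galois.

Lemma Si1 : Si 1 = 1. Proof. by rewrite -{1}(@S1 k H) Si_S. Qed.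

Lemma SiM h g : Si (h * g) = Si g * Si h.
Proof. by rewrite -[RHS]Si_S SM !S_Si. Qed.

Lemma Si_r U (F : H -> H -> U) y : bilinear_map F ->
  \Δ_(b, x <- y) \Δ_(u, v <- x) F b (v * Si u) = F y 1.
Proof.
move=> bF; rewrite -[in RHS]Si1 -(@Sr_r _ _ _ (fun b z => F b (Si z))); last by lin.
by do 2!peel; rewrite SiM Si_S.
Qed.

Lemma Si_eps U (G : H -> U) h : islin G ->
  \Δ_(u, v <- h) G (Si v * u) = (eps h : k) *: G 1.
Proof.
move=> lG; rewrite -Si1 -(@Sl _ _ _ (fun z => G (Si z))); last by lin.
by peel; rewrite SiM Si_S.
Qed.

Lemma Si_l U (F : H -> H -> U) y : bilinear_map F ->
  \Δ_(b, x <- y) \Δ_(u, v <- x) F b (Si v * u) = F y 1.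
Proof.
move=> bF; rewrite -[in RHS]Si1 -(@Sl_r _ _ _ (fun b z => F b (Si z))); last by lin.
by do 2!peel; rewrite SiM Si_S.
Qed.

Section LeftHopf.
Local Notation rD := (fun (b : B) (x : L) => x ∙ co b).
Local Notation lD := (fun (b : B) (y : L) => co b ∙ y).
Local Notation DT := (Defs_btensor__canonical__GRing_Lmodule rD lD).
Variables (dt : L -> L -> DT) (dt_def : dt = btens rD lD).
Let bdt := dt_bilinear dt_def.

Definition lam_fun (x y : L) : BT := blift (fun x1 x2 => bt x1 (x2 ∙ y)) (Dl x).

Let b0 y : bilinear_map (fun x1 x2 => bt x1 (x2 ∙ y)). Proof. by lin. Qed.
Let c0 y : bal (fun x1 x2 => bt x1 (x2 ∙ y)).
Proof. by move=> b x1 x2; rewrite bt_bal amA. Qed.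

Lemma lam_bilinear : bilinear_map lam_fun.
Proof.
apply: bilinI => [y|x]; first exact: (blift_Dl_lin (b0 y) (c0 y)).
by rewrite /lam_fun; lin.
Qed.

Lemma lam_bal : isbal rD lD lam_fun.
Proof.
move=> b x y; rewrite /lam_fun Dl_mul_tgt (lift_comp _ _ (lift_lin (b0 y) (c0 y))).
by apply: eq_blift => x1 x2; rewrite (lift_bt (b0 y) (c0 y)) amA.
Qed.

Lemma lam_tens a h y : lam_fun (a # h) y = \Δ_(h1, h2 <- h) bt (a # h1) ((one # h2) ∙ y).
Proof. by rewrite /lam_fun (blift_Dl (b0 y) (c0 y)). Qed.

Definition lam_inv (z : L) (g : H) : DT :=
  tlift (fun a h => \Δ_(h1, h2 <- h) dt (a # h1) (one # (g * Si h2))) z.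

Lemma lam_inv_bilinear : bilinear_map lam_inv.
Proof. by rewrite /lam_inv; lin. Qed.
Let blinv := lam_inv_bilinear.

Lemma lam_inv_tens a h g :
  lam_inv (a # h) g = \Δ_(h1, h2 <- h) dt (a # h1) (one # (g * Si h2)).
Proof. by rewrite /lam_inv; apply: tlift_tens; lin. Qed.

(** By [tgt_am] the right side is b_(0) # g S^-1(b_(2)) b_(1).  The identity writes
    b # g in terms of the target map, across which the source tensor product of
    the Galois map is balanced. *)
Lemma tgt_decomp b g : b # g = \cw_(b0, b1 <- b) (co b0 ∙ (one # (g * Si b1))).
Proof.
transitivity (\cw_(b0, b1 <- b) \cw_(c0, c1 <- b0) (c0 # (g * (Si b1 * c1)))); last first.
  apply: eq_tlift => b0' b1; rewrite tgt_am; apply: eq_tlift => c0' c1.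
  by rewrite m1l mulrA.
rewrite (@coA _ (fun c0 c1 x => c0 # (g * (Si x * c1)))); try by move=> *; lin.
rewrite -[LHS](@co_counitE _ (fun b => b # g)); last by lin.
apply: eq_tlift => b0' b1.
rewrite (@Si_eps _ (fun z => b0' # (g * z))); last by lin.
by rewrite mulr1.
Qed.

Lemma lam_lam_inv z g : blift lam_fun (lam_inv z g) = bt z (one # g).
Proof.
have blam := lam_bilinear.
have llam : islin (blift lam_fun : DT -> BT) by apply: blift_lin blam lam_bal.
move: z; apply: L_ext; [by apply: (lin_comp llam); lin | by lin |] => a h.
rewrite lam_inv_tens (sw2_comp _ _ llam).
transitivity (\Δ_(x, h3 <- h) \Δ_(h1, h2 <- x) bt (a # h1) (one # (g * (Si h3 * h2)))).
  apply: eq_sw2 => x h3.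
  transitivity (lam_fun (a # x) (one # (g * Si h3))).
    by rewrite dt_def; apply: blift_tens lam_bal.
  by rewrite lam_tens; apply: eq_sw2 => h1 h2; rewrite am_one mulrA.
sw [:: h] [:: 0; 1]%N.
rewrite (@Si_l _ (fun h1 z => bt (a # h1) (one # (g * z)))); last by lin.
by rewrite mulr1.
Qed.

(** The image of (a # h) ⊗ (b # g) is brought to the form x ⊗ (1 # g) by [btE], where
    the Drinfeld–Yetter condition rewrites the coaction of b ◁ h_2.  After the
    application of [lam_inv] the legs of h cancel; what remains is
    (a # h) t(b_(0)) ⊗ (1 # g S^-1(b_(1))), and [tgt_decomp] identifies it. *)
Lemma lam_inv_lam x y :
  blift (fun x y : L => tlift (fun b g => lam_inv (co b ∙ x) g) y) (lam_fun x y) = dt x y.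
Proof.
have blam := lam_bilinear; have [bQ balQ] := bal_of_pure lam_inv_bilinear.
have lQ := lift_lin bQ balQ.
move: x; apply: L_ext; [by apply: (lin_comp lQ); lin | by lin |] => a h.
move: y; apply: L_ext; [by apply: (lin_comp lQ); lin | by lin |] => b g.
transitivity (\cw_(b0, b1 <- b) \Δ_(u, v <- b1) \Δ_(h1, h2 <- h)
  dt (m a (act b0 h1) # (u * h2)) (one # (g * Si v))).
  rewrite lam_tens (sw2_comp _ _ lQ).
  transitivity (\Δ_(h1, h2, h3 <- h) \cw_(c0, c1 <- act b h2)
    lam_inv (m a c0 # (h1 * c1)) (g * h3)).
    apply: eq_sw2 => h1 t; rewrite one_am (sw2_comp _ _ (proj2 bbt _)) (sw2_comp _ _ lQ).
    apply: eq_sw2 => h2 h3; rewrite (lift_bt bQ balQ).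
    refine (etrans (bal_of_pure_tens (a # h1) (act b h2) (g * h3) lam_inv_bilinear) _).
    rewrite tgt_am; refine (@tlift_comp _ _ _ _ _ (fun z => lam_inv z (g * h3)) _ _ _).
    by lin.
  transitivity (\Δ_(p, h3 <- h) \cw_(b0, b1 <- b) \Δ_(h1, h2 <- p)
    lam_inv (m a (act b0 h1) # (b1 * h2)) (g * h3)).
    sw [:: h] [:: 0; 0]%N; apply: eq_sw2 => p h3.
    by refine (@compat _ (fun c0 z => lam_inv (m a c0 # z) (g * h3)) b p _); lin.
  transitivity (\cw_(b0, b1 <- b) \Δ_(p, h3 <- h) \Δ_(h1, h2 <- p)
    lam_inv (m a (act b0 h1) # (b1 * h2)) (g * h3)).
    exact: tlift_swap.
  apply: eq_tlift => b0' b1.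
  transitivity (\Δ_(p, h4 <- h) \Δ_(h1, t <- p) \Δ_(u, v <- b1) \Δ_(h2, h3 <- t)
    dt (m a (act b0' h1) # (u * h2)) (one # (g * (h4 * Si h3) * Si v))).
    do 2!peel; rewrite lam_inv_tens sw2_mul; last by lin.
    by do 2!peel; rewrite SiM !mulrA.
  sw [:: b1; h] [:: 0; 2; 3; 4]%N; apply: eq_sw2 => u v; apply: eq_sw2 => h1 t.
  rewrite (@Si_r _ (fun h2 z => dt (m a (act b0' h1) # (u * h2)) (one # (g * z * Si v))));
    last by lin.
  by rewrite mulr1.
rewrite (tgt_decomp b g) (tlift_comp _ _ (proj2 bdt _)).
rewrite -(@coA _ (fun b0 u v => \Δ_(h1, h2 <- h)
  dt (m a (act b0 h1) # (u * h2)) (one # (g * Si v)))); try by move=> *; lin.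
apply: eq_tlift => b0' b1; rewrite -(dt_bal dt_def) am_tgt.
rewrite (@tlift_comp _ _ _ _ _ (fun z => dt z (one # (g * Si b1)))); last by lin.
apply: eq_tlift => c0' c1.
by rewrite (@sw2_comp _ _ _ _ (fun z => dt z (one # (g * Si b1)))); last by lin.
Qed.

Lemma lam_bij : bijective (blift lam_fun : DT -> BT).
Proof.
exact: (galois_bij dt_def lam_bilinear lam_bal lam_inv_bilinear lam_lam_inv lam_inv_lam).
Qed.
End LeftHopf.

Section AntiLeftHopf.
Local Notation rD := (fun (b : B) (x : L) => x ∙ sr b).
Local Notation lD := (fun (b : B) (y : L) => sr b ∙ y).
Local Notation DT := (Defs_btensor__canonical__GRing_Lmodule rD lD).
Variables (dt : L -> L -> DT) (dt_def : dt = btens rD lD).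
Let bdt := dt_bilinear dt_def.

Definition mu_fun (x y : L) : BT := blift (fun x1 x2 => bt (x1 ∙ y) x2) (Dl x).

Let b0 y : bilinear_map (fun x1 x2 => bt (x1 ∙ y) x2). Proof. by lin. Qed.
Let c0 y : bal (fun x1 x2 => bt (x1 ∙ y) x2).
Proof. by move=> b x1 x2; rewrite -amA bt_bal. Qed.

Lemma mu_bilinear : bilinear_map mu_fun.
Proof.
apply: bilinI => [y|x]; first exact: (blift_Dl_lin (b0 y) (c0 y)).
by rewrite /mu_fun; lin.
Qed.

Lemma mu_bal : isbal rD lD mu_fun.
Proof.
move=> b x y; rewrite /mu_fun Dl_mul_src (lift_comp _ _ (lift_lin (b0 y) (c0 y))).
by apply: eq_blift => x1 x2; rewrite (lift_bt (b0 y) (c0 y)) amA.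
Qed.

Lemma mu_tens a h g :
  mu_fun (a # h) (one # g) = \Δ_(h1, h2 <- h) bt (a # (g * h1)) (one # h2).
Proof.
rewrite /mu_fun (blift_Dl (b0 _) (c0 _)); apply: eq_sw2 => h1 h2.
by rewrite am_one.
Qed.

Definition mu_inv (z : L) (g : H) : DT :=
  tlift (fun a h => \Δ_(g1, g2 <- g) dt (a # g2) (one # (h * S g1))) z.

Lemma mu_inv_bilinear : bilinear_map mu_inv.
Proof. by rewrite /mu_inv; lin. Qed.
Let bminv := mu_inv_bilinear.

Lemma mu_inv_tens a h g :
  mu_inv (a # h) g = \Δ_(g1, g2 <- g) dt (a # g2) (one # (h * S g1)).
Proof. by rewrite /mu_inv; apply: tlift_tens; lin. Qed.

Lemma mu_mu_inv z g : blift mu_fun (mu_inv z g) = bt z (one # g).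
Proof.
have bmu := mu_bilinear.
have lmu : islin (blift mu_fun : DT -> BT) by apply: blift_lin bmu mu_bal.
move: z; apply: L_ext; [by apply: (lin_comp lmu); lin | by lin |] => a h.
rewrite mu_inv_tens (sw2_comp _ _ lmu).
transitivity (\Δ_(g1, t <- g) \Δ_(g2, g3 <- t) bt (a # (h * (S g1 * g2))) (one # g3)).
  apply: eq_sw2 => g1 t.
  transitivity (mu_fun (a # t) (one # (h * S g1))).
    by rewrite dt_def; apply: blift_tens mu_bal.
  by rewrite mu_tens; apply: eq_sw2 => g2 g3; rewrite !mulrA.
sw [:: g] [:: 0; 0]%N.
rewrite (@Sl_l _ _ _ (fun z g3 => bt (a # (h * z)) (one # g3))); last by lin.
by rewrite mulr1.
Qed.

Lemma mu_inv_mu x y :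
  blift (fun x y : L => tlift (fun b g => mu_inv (co b ∙ x) g) y) (mu_fun x y) = dt x y.
Proof.
have bmu := mu_bilinear; have [bQ balQ] := bal_of_pure mu_inv_bilinear.
have lQ := lift_lin bQ balQ.
move: y; apply: L_ext; [by apply: (lin_comp lQ); lin | by lin |] => b g.
(* b # g = s(b) (1 # g) can be moved to the left factor *)
rewrite -{1 2}[b]m1r -src_am -mu_bal -(dt_bal dt_def); move: (x ∙ sr b) => {x} x.
move: x; apply: L_ext; [by apply: (lin_comp lQ); lin | by lin |] => a h.
rewrite mu_tens (sw2_comp _ _ lQ).
transitivity (\Δ_(h1, t <- h) \Δ_(h2, h3 <- t) dt (a # h3) (one # (g * (h1 * S h2)))).
  apply: eq_sw2 => h1 t; rewrite (lift_bt bQ balQ).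
  refine (etrans (bal_of_pure_tens (a # (g * h1)) one t mu_inv_bilinear) _).
  rewrite co_one am1l mu_inv_tens; apply: eq_sw2 => h2 h3.
  by rewrite mulrA.
sw [:: h] [:: 0; 0]%N.
rewrite (@Sr_l _ _ _ (fun z h3 => dt (a # h3) (one # (g * z)))); last by lin.
by rewrite mulr1.
Qed.

Lemma mu_bij : bijective (blift mu_fun : DT -> BT).
Proof.
exact: (galois_bij dt_def mu_bilinear mu_bal mu_inv_bilinear mu_mu_inv mu_inv_mu).
Qed.
End AntiLeftHopf.


(** * The action Hopf algebroid of the transmuted algebra *)

Definition total : bialgebroid_data B L := @BialgebroidData k B L m one am (one # 1) sr co Dl cnt.

Lemma total_left_bialgebroid : is_left_bialgebroid total.
Proof.
have btD x y : bimod_tens total x y = bt x y by rewrite bt_def.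
have clD u : bimod_class total u =
  bclass (fun b x => am (co b) x) (fun b y => am (sr b) y) u by [].
split.
- exact: bca_algebra hD.
- by split; [exact: am_bilinear | exact: amA | exact: am1l | exact: am1r].
- exact: lsr.
- exact: srE.
- exact: srM.
- exact: lco.
- exact: co_one.
- exact: coM.
- exact: sr_co.
- exact: lDl.
- move=> b x; refine (etrans (Dl_src b x) _); apply: eq_blift => x1 x2; exact: esym.
- move=> b x; refine (etrans (Dl_tgt b x) _); apply: eq_blift => x1 x2; exact: esym.
- exact: lcnt.
- exact: cnt_src.
- exact: cnt_tgt.
- pose C := lclass (bimod_tensor3_rel total).
  have lC : islin C by exact: lclass_linear.
  apply: (@Dl_coassoc _ (bimod_tens3 total)).
  + by move=> T f y z lf; rewrite /bimod_tens3; apply: (lin_comp lC); lin.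
  + by move=> T f y z lf; rewrite /bimod_tens3; apply: (lin_comp lC); lin.
  + by move=> T f y z lf; rewrite /bimod_tens3; apply: (lin_comp lC); lin.
  + by move=> b x y z; apply/lclass_eqP; apply: lspan_gen; left; exists b, x, y, z.
  + by move=> b x y z; apply/lclass_eqP; apply: lspan_gen; right; exists b, x, y, z.
- exact: cnt_counitl.
- exact: cnt_counitr.
- move=> x b; refine (etrans _ (etrans (takeuchi x b) _)); apply: eq_blift => x1 x2.
    exact: btD.
  exact: esym.
- by rewrite btD; apply: Dl_one.
- move=> x y u v eu ev; refine (etrans (Dl_mul eu ev) _).
  by apply: eq_tlift => x1 x2; apply: eq_tlift => y1 y2; rewrite btD.
- exact: cnt_one.
- exact: cntM_src.
- exact: cntM_tgt.
Qed.

Lemma blift_map (V W U : lmodType k) (rD : B -> V -> V) (lD : B -> W -> W) (f : V -> W -> U) :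
  bilinear_map f -> isbal rD lD f -> bijective (blift f : btensor rD lD -> U) ->
  exists lam : {linear btensor rD lD -> U},
    (forall x y, lam (btens rD lD x y) = f x y) /\ bijective lam.
Proof.
move=> bf balf bij; pose Q := blift f : btensor rD lD -> U.
have lQ : linear Q by apply: blift_lin.
pose g := GRing.isLinear.Build k _ U _ Q lQ.
exists (HB.pack Q g : {linear btensor rD lD -> U}); split=> // x y.
exact: blift_tens.
Qed.

Lemma total_left_hopf : is_left_hopf total.
Proof.
have [lam [lamE lam_b]] := blift_map lam_bilinear lam_bal (lam_bij erefl).
exists lam; split=> [x y|//]; rewrite lamE /lam_fun; apply: eq_blift => x1 x2.
by rewrite bt_def.
Qed.

Lemma total_anti_left_hopf : is_anti_left_hopf total.
Proof.
have [mu [muE mu_b]] := blift_map mu_bilinear mu_bal (mu_bij erefl).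
exists mu; split=> [x y|//]; rewrite muE /mu_fun; apply: eq_blift => x1 x2.
by rewrite bt_def.
Qed.

Lemma total_hopf_algebroid : is_hopf_algebroid total.
Proof.
split; [exact: total_left_bialgebroid | exact: total_left_hopf | exact: total_anti_left_hopf].
Qed.

End Action.

(* The structure maps of H are unfolded again, to compare with their bundled forms. *)
#[global] Transparent S eps cop.

Lemma underlineE (k : fieldType) (H : hopfAlgType k) (R : {linear (H ⊗ H)%type -> k^o})
  (r := fun x y : H => R (x ⊗ y) : k^o) : bilinear_map r ->
  underline R = DYAlgebraData (tmul r) 1 (tact r) (@ad k H).
Proof.
move=> br; rewrite /underline; congr DYAlgebraData.
- apply/funext => h; apply/funext => g.
  rewrite /underline_mul.
  transitivity (\sw3_(h1 ⊗ h2 ⊗ h3 <- comul2 h) \Δ_(g1, g2, g3 <- g)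
    (((r h3 (S g1) : k) * r h1 g2) *: (h2 * g3))).
    apply: eq_tlift => p z; apply: eq_tlift => x y.
    by apply: (@sw3E k H H (fun g1 g2 g3 => ((r z (S g1) : k) * r x g2) *: (y * g3)) g); lin.
  by apply: sw3E; lin.
- apply/funext => h; apply/funext => g; rewrite /underline_act.
  by apply: (@sw3E k H H (fun h1 h2 h3 => \Δ_(g1, g2 <- g) ((r g1 h1 : k) * r h3 g2) *: h2)); lin.
- apply/funext => h; rewrite /underline_coact.
  by apply: (@sw3E k H _ (fun h1 h2 h3 => h2 ⊗ (S h1 * h3))); lin.
Qed.

Lemma underline_bca (k : fieldType) (H : hopfAlgType k) (r : H -> H -> k^o) (hr : coquasi r) :
  is_braided_commutative_algebra (DYAlgebraData (tmul r) 1 (tact r) (@ad k H)).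
Proof.
split=> /=.
- split.
  + exact: tact_bilinear hr.
  + exact: tact1 hr.
  + exact: tactM hr.
  + exact: ad_linear.
  + exact: ad_counit.
  + exact: adA.
  + exact: tact_ad_compat hr.
- split.
  + exact: tmul_bilinear hr.
  + exact: tmulA hr.
  + exact: tmul1l hr.
  + exact: tmul1r hr.
- exact: tact_one hr.
- exact: tact_tmul hr.
- exact: ad_one.
- exact: ad_tmul hr.
- exact: tmul_braided_comm hr.
Qed.

Theorem action_hopf_algebroid (k : fieldType) (H : hopfAlgType k) (B : lmodType k)
  (D : dy_algebra_data H B) (Si : H -> H) : is_braided_commutative_algebra D ->
  islin Si -> cancel Si (@S k H) -> cancel (@S k H) Si ->
  is_hopf_algebroid (action_bialgebroid D).
Proof.
move=> hD lSi S_Si Si_S.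
exact: (@total_hopf_algebroid k H B D hD Si lSi S_Si Si_S _ erefl _ erefl _ erefl _ erefl
  _ erefl _ erefl).
Qed.

Theorem theorem5p14 (k : fieldType) (H : hopfAlgType k)
    (R : {linear (H ⊗ H)%type -> k^o}) (hR : coquasitriangular R) :
  is_braided_commutative_algebra (underline R) /\
  is_hopf_algebroid (action_bialgebroid (underline R)).
Proof.
have hr := coquasi_of hR.
have hB : is_braided_commutative_algebra (underline R).
  by rewrite (underlineE (coquasi_bilinear hr)); apply: underline_bca.
split; first exact: hB.
refine (action_hopf_algebroid (Si := Sinv (fun x y => R (x ⊗ y))) hB _ _ _).
- exact: Sinv_lin hr.
- exact: S_Sinv hr.
- exact: Sinv_S hr.
Qed.
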